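(* Let $n\ge1$, $\gamma\in\mathbb{R}$ and $n<p<+\infty$. There exists a constant $C>0$ such that, whenever $\omega\in C(\mathbb{R}^n_+\times\mathbb{R}^n_+,[0,+\infty))$ is such that every $u\in\dot W^{1,p}_\gamma(\mathbb{R}^n_+)$ satisfies, for almost every $x,y\in\mathbb{R}^n_+$, \[ |u(x)-u(y)|\le\omega(x,y)\Big(\int_{\mathbb{R}^n_+}|Du(z)|^pz_n^\gamma\,dz\Big)^{1/p}, \] then for all $x,y\in\mathbb{R}^n_+$, $\omega(x,y)\ge C\,\Theta_{1-\frac1p,\,1-\frac np,\,1-\frac{n+\gamma}{p}}(x,y)$.
   Context: $\mathbb{R}^n_+=\mathbb{R}^{n-1}\times(0,+\infty)$, points written $x=(x',x_n)$. $\dot W^{1,p}_\gamma(\mathbb{R}^n_+)=\{u\in W^{1,1}_{\mathrm{loc}}(\mathbb{R}^n_+): \int_{\mathbb{R}^n_+}|Du(z)|^p z_n^\gamma\,dz<+\infty\}$. For $\alpha>0$, $\beta,\kappa\in\mathbb{R}$: $\Theta_{\alpha,\beta,\kappa}(x,y)=\frac{|x-y|^\beta}{\min(x_n,y_n)^{-\kappa}\max(x_n,y_n,|x-y|)^\beta}$ if $\kappa<0$; $=\big(\ln(1+(|x-y|/\min(x_n,y_n))^{\beta/\alpha})\big)^\alpha$ if $\kappa=0$; $=\frac{|x-y|^\beta}{\max(x_n,y_n,|x-y|)^{\beta-\kappa}}$ if $0<\kappa<1+\beta-\alpha$; $=\frac{\max(x_n,y_n)^\kappa|x-y|^\beta}{\max(x_n,y_n,|x-y|)^\beta}$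 if $\kappa\ge 1+\beta-\alpha$. *)

(* Defs.v *)
From HB Require Import structures.
From mathcomp Require Import all_boot all_order all_algebra.
From mathcomp Require Import all_classical all_reals all_analysis.
Set Implicit Arguments. Unset Strict Implicit. Unset Printing Implicit Defensive.
Import Order.TTheory GRing.Theory Num.Theory.
Import numFieldNormedType.Exports.
Local Open Scope classical_set_scope.
Local Open Scope ring_scope.

(* Points of R^N are row vectors 'rV[R]_N; the half-space R^N_+ uses the
   last coordinate.  We work with N = m.+1 >= 1, so the last index is ord_max. *)

Section Defs.
Variable R : realType.

(* Euclidean norm (NB: the library norm on 'rV is the max-norm) *)
Definition enorm (N : nat) (v : 'rV[R]_N) : R := Num.sqrt (\sum_(i < N) v ord0 i ^+ 2).

Definition lastc (m : nat) (x : 'rV[R]_m.+1) : R := x ord0 ord_max.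

Definition halfspace (m : nat) : set 'rV[R]_m.+1 := [set x | 0 < lastc x].

Definition box (N : nat) (a b : 'rV[R]_N) : set 'rV[R]_N :=
  [set x | forall i, a ord0 i < x ord0 i <= b ord0 i].

Definition boxes (N : nat) : set (set 'rV[R]_N) :=
  [set B | exists a b, B = box a b].

(* R^N with its Borel sigma-algebra (generated by boxes) *)
Definition Rn (N : nat) := g_sigma_algebraType (@boxes N).

(* mu is the N-dimensional Lebesgue measure (on Borel sets): the measure of a
   box is the product of its side lengths (this determines mu uniquely) *)
Definition is_lebesgue (N : nat) (mu : {measure set (Rn N) -> \bar R}) : Prop :=
  forall a b : 'rV[R]_N, (forall i, a ord0 i <= b ord0 i) ->
    mu (box a b) = (\prod_(i < N) (b ord0 i - a ord0 i))%:E.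

Definition evec (N : nat) (i : 'I_N) : 'rV[R]_N := delta_mx ord0 i.

Fixpoint Ck (N : nat) (k : nat) (f : 'rV[R]_N -> R) : Prop :=
  match k with
  | 0%N => continuous f
  | k'.+1 => continuous f /\
      forall i : 'I_N, (forall x, derivable f x (evec i)) /\ Ck k' ('D_(evec i) f)
  end.

Definition smooth (N : nat) (f : 'rV[R]_N -> R) : Prop := forall k, Ck k f.

Definition test_fun (m : nat) (phi : 'rV[R]_m.+1 -> R) : Prop :=
  smooth phi /\ exists K : set 'rV[R]_m.+1,
    compact K /\ K `<=` @halfspace m /\ forall x, ~ K x -> phi x = 0.

Definition loc_integrable (m : nat) (mu : {measure set (Rn m.+1) -> \bar R})
  (f : 'rV[R]_m.+1 -> R) : Prop :=
  forall K : set 'rV[R]_m.+1, compact K -> K `<=` @halfspace m ->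
    mu.-integrable (K : set (Rn m.+1)) (fun x => (f x)%:E).

Definition weak_gradient (m : nat) (mu : {measure set (Rn m.+1) -> \bar R})
  (u : 'rV[R]_m.+1 -> R) (Du : 'rV[R]_m.+1 -> 'rV[R]_m.+1) : Prop :=
  loc_integrable mu u /\
  (forall i, loc_integrable mu (fun x => Du x ord0 i)) /\
  forall phi, test_fun phi -> forall i : 'I_m.+1,
    (\int[mu]_(x in (@halfspace m : set (Rn m.+1))) (u x * 'D_(evec i) phi x)%:E
     = - \int[mu]_(x in (@halfspace m : set (Rn m.+1))) (Du x ord0 i * phi x)%:E)%E.

Definition wenergy (m : nat) (mu : {measure set (Rn m.+1) -> \bar R})
  (p gamma : R) (Du : 'rV[R]_m.+1 -> 'rV[R]_m.+1) : \bar R :=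
  (\int[mu]_(z in (@halfspace m : set (Rn m.+1)))
     ((enorm (Du z)) `^ p * (lastc z) `^ gamma)%:E)%E.

Definition Theta (m : nat) (alpha beta kappa : R) (x y : 'rV[R]_m.+1) : R :=
  let d := enorm (x - y) in
  let mn := Num.min (lastc x) (lastc y) in
  let mx := Num.max (lastc x) (lastc y) in
  let M := Num.max mx d in
  if kappa < 0 then d `^ beta / (mn `^ (- kappa) * M `^ beta)
  else if kappa == 0 then (ln (1 + (d / mn) `^ (beta / alpha))) `^ alpha
  else if kappa < 1 + beta - alpha then d `^ beta / M `^ (beta - kappa)
  else mx `^ kappa * d `^ beta / M `^ beta.

End Defs.

(* Main.v *)
Require Import Defs.
From HB Require Import structures.
From mathcomp Require Import all_boot all_order all_algebra.
From mathcomp Require Import all_classical all_reals all_analysis.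
From mathcomp Require Import measurable_realfun ring lra.
Set Implicit Arguments. Unset Strict Implicit. Unset Printing Implicit Defensive.
Import Order.TTheory GRing.Theory Num.Theory.
Import numFieldNormedType.Exports.
Local Open Scope classical_set_scope.
Local Open Scope ring_scope.

(** Testing the inequality on one function [u] bounds [omega x y] from below by
    [|u x - u y| / energy(u)^(1/p)], so each regime of [Theta] needs one test
    function.  Let [a <= b] be the heights of the two points and [d] their
    distance.  A bump that equals 1 on a ball and vanishes off a slightly larger
    one, of radius comparable to [min d a] (resp. [min d b]) and centered at the
    lower (resp. upper) point, stays in a region where the weight is almost
    constant; it settles [kappa < 0], [kappa >= 1 + beta - alpha] and all cases
    with [d <= 2 a].  When [d > 2 a] and [0 < kappa < 1 + beta - alpha], so that
    [gamma > -1], the bump has radius [d / 2] and is centered at the projection of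
    the lower point to the boundary, the weight being integrated over dyadic
    layers.  For [kappa = 0] the bumps of radii [a, 2 a, 4 a, ..] up to [d / 2]
    around that projection have bounded energies and gradients with disjoint
    supports, so their sum is a logarithm-like function whose oscillation and
    energy are both comparable to the number of scales.

    The measure is only known on boxes, so integration by parts is derived without
    Fubini: by uniqueness of measures it is translation invariant, hence the
    integral of a difference quotient of a compactly supported [C^1] function is 0,
    and dominated convergence gives the same for its partial derivatives. *)

(** * Borel sets and translations *)

Section HalfSpaceMeasure.
Context {R : realType}.

Lemma ball_rowP (N : nat) (x y : 'rV[R]_N) (e : R) : 0 < e ->
  ball x e y <-> forall i, `|x ord0 i - y ord0 i| < e.
Proof.
move=> e0; split.
  by move=> [_ H] i; have := H ord0 i.
move=> H; split => // i j; rewrite (ord1 i); exact: H.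
Qed.

Lemma box_measurable (N : nat) (a b : 'rV[R]_N) :
  measurable (box a b : set (Rn R N)).
Proof. by apply: sub_sigma_algebra; exists a, b. Qed.

(** The boxes with rational corners contained in [O] are countably many and cover it. *)
Lemma open_measurable_Rn (N : nat) (O : set 'rV[R]_N) :
  open O -> measurable (O : set (Rn R N)).
Proof.
move=> oO.
pose r2R (a : 'rV[rat]_N) : 'rV[R]_N := map_mx ratr a.
pose F (n : nat) : set (Rn R N) :=
  if unpickle n is Some (a, b) then
    if `[< box (r2R a) (r2R b) `<=` O >] then box (r2R a) (r2R b) else set0
  else set0.
have -> : O = \bigcup_n F n.
  apply/seteqP; split=> [x Ox|x [n _]]; last first.
    rewrite /F; case: unpickle => [[a b]|//].
    by case: asboolP => // H; exact: H.
  move: oO; rewrite openE => /(_ _ Ox) /nbhs_ballP[e /= e0 sub].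
  have ha i : exists q : rat, x ord0 i - e < ratr q < x ord0 i.
    have /rat_in_itvoo[q] : x ord0 i - e < x ord0 i by rewrite ltrBlDr ltrDl.
    by rewrite in_itv /=; exists q.
  have hb i : exists q : rat, x ord0 i < ratr q < x ord0 i + e.
    have /rat_in_itvoo[q] : x ord0 i < x ord0 i + e by rewrite ltrDl.
    by rewrite in_itv /=; exists q.
  have [fa fap] := choice ha; have [fb fbp] := choice hb.
  exists (pickle (\row_i fa i, \row_i fb i)) => //.
  rewrite /F pickleK asboolT.
    move=> i; rewrite !mxE; have := fap i; have := fbp i.
    by move=> /andP[h _] /andP[_ ->]; rewrite ltW.
  move=> y yb; apply: sub; apply/ball_rowP => // i.
  have := yb i; rewrite !mxE; have := fap i; have := fbp i.
  move=> /andP[? ?] /andP[? ?] /andP[? ?]; rewrite ltr_norml; apply/andP; split; lra.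
apply: bigcupT_measurable => n; rewrite /F.
case: unpickle => [[a b]|//]; case: asboolP => // _; exact: box_measurable.
Qed.

Lemma closed_measurable_Rn (N : nat) (A : set 'rV[R]_N) :
  closed A -> measurable (A : set (Rn R N)).
Proof.
move=> cA; rewrite -(setCK A); apply: measurableC.
by apply: open_measurable_Rn; exact: closed_openC.
Qed.

Lemma compact_measurable_Rn (N : nat) (A : set 'rV[R]_N) :
  compact A -> measurable (A : set (Rn R N)).
Proof.
move=> cA; apply: closed_measurable_Rn; apply: compact_closed cA.
exact: norm_hausdorff.
Qed.

Lemma continuous_measurable_Rn (N : nat) (f : 'rV[R]_N -> R) :
  continuous f -> measurable_fun setT (f : Rn R N -> R).
Proof.
move=> cf; apply: (measurability _ (RGenOInfty.measurableE R)).
move=> /= _ [_ [a ->]] <-; rewrite setTI.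
apply: open_measurable_Rn.
by apply: open_comp => // x _; exact: cf.
Qed.

Lemma row_coord_continuous (N : nat) (i : 'I_N) :
  continuous (fun x : 'rV[R]_N => x ord0 i).
Proof. by move=> x; exact: coord_continuous. Qed.

Lemma open_halfspace (m : nat) : open (@halfspace R m).
Proof.
have -> : @halfspace R m = (fun x : 'rV[R]_m.+1 => x ord0 ord_max) @^-1` `]0, +oo[.
  by apply/seteqP; split => x; rewrite /halfspace /lastc /= in_itv /= andbT.
apply: open_comp; last exact: interval_open.
by move=> x _; exact: row_coord_continuous.
Qed.

Lemma box_setI (N : nat) (a b c d : 'rV[R]_N) :
  box a b `&` box c d =
  box (\row_i Num.max (a ord0 i) (c ord0 i)) (\row_i Num.min (b ord0 i) (d ord0 i)).
Proof.
apply/seteqP; split => x /=.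
  move=> [h1 h2] i; rewrite !mxE gt_max le_min.
  by have /andP[-> ->] := h1 i; have /andP[-> ->] := h2 i.
move=> h; split=> i; have := h i; rewrite !mxE gt_max le_min;
by move=> /andP[/andP[? ?] /andP[? ?]]; apply/andP.
Qed.

Lemma continuous_translation (N : nat) (v : 'rV[R]_N) :
  continuous (fun x : 'rV[R]_N => x + v).
Proof. by move=> x; exact: (@cvgD R _ _ (nbhs x) _ id (cst v) x v cvg_id (cvg_cst v)). Qed.

Lemma measurable_translation (N : nat) (v : 'rV[R]_N) :
  measurable_fun setT ((fun x => x + v) : Rn R N -> Rn R N).
Proof.
apply: (@measurability _ _ (Rn R N) (Rn R N) setT _ (@boxes R N) erefl).
move=> _ [_ [a [b ->]] <-]; rewrite setTI.
rewrite (_ : _ @^-1` _ = (box (a - v) (b - v) : set (Rn R N))).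
  exact: box_measurable.
apply/seteqP; split => x /= h i; have := h i; rewrite !mxE;
by rewrite ltrBlDr lerBrDr.
Qed.

Section Lebesgue.
Context {N : nat} (mu : {measure set (Rn R N) -> \bar R}).
Hypothesis mu_leb : is_lebesgue mu.

Lemma box_lty (a b : 'rV[R]_N) : (mu (box a b) < +oo)%E.
Proof.
case: (pselect (forall i, a ord0 i <= b ord0 i)) => [ab|nab].
  by rewrite (mu_leb ab) ltry.
rewrite (_ : box a b = set0) ?measure0 ?ltry //.
apply/seteqP; split => // x xb; apply: nab => i.
by have /andP[/ltW h1 h2] := xb i; exact: le_trans h1 h2.
Qed.

(** [mu] and its image under the translation agree on boxes, which are stable under intersection,
    generate the sigma-algebra, and include cubes of finite measure exhausting the space. *)
Lemma lebesgue_translation (v : 'rV[R]_N) (A : set (Rn R N)) :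
  measurable A -> mu ((fun x => x + v) @^-1` A) = mu A.
Proof.
move=> mA.
pose T : Rn R N -> Rn R N := fun x => x + v.
have mT : measurable_fun setT T := measurable_translation v.
pose g (n : nat) : set (Rn R N) := box (const_mx (- n%:R)) (const_mx n%:R).
symmetry.
have U := @measure_unique _ R (Rn R N) (@boxes R N) g _ _ _ _ mu (pushforward mu T).
apply: (U _ _ _ _ mT) mA => //; rewrite /g {U}.

- by move=> _ _ [a [b ->]] [c [d ->]]; rewrite box_setI; do 2 eexists.
- by move=> n; do 2 eexists.
- apply/seteqP; split => // x _.
  pose M := \sum_(i < N) `|x ord0 i|.
  have [n nM] : exists n : nat, M < n%:R.
    by exists (Num.bound M); apply: archi_boundP; apply: sumr_ge0.
  exists n => // i; rewrite !mxE.
  have : `|x ord0 i| <= M.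
    by rewrite /M (bigD1 i) //= lerDl; apply: sumr_ge0.
  by rewrite ler_norml => /andP[? ?]; apply/andP; split; lra.
- move=> _ [a [b ->]] /=.
  rewrite /pushforward /=.
  have -> : (fun x => x + v) @^-1` (box a b) = box (a - v) (b - v).
    apply/seteqP; split => x /= h i; have := h i; rewrite !mxE;
    by rewrite ltrBlDr lerBrDr.
  (* [is_lebesgue] speaks of ordered corners only; otherwise both boxes are empty. *)
  case: (pselect (forall i, a ord0 i <= b ord0 i)) => [ab|nab].
    rewrite (mu_leb ab) mu_leb; last by move=> i; rewrite !mxE lerD2r.
    by congr (_%:E); apply: eq_bigr => i _; rewrite !mxE; ring.
  have e (c d : 'rV[R]_N) : ~ (forall i, c ord0 i <= d ord0 i) -> box c d = set0.
    move=> ncd; apply/seteqP; split => // x xb; apply: ncd => i.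
    by have /andP[/ltW h1 h2] := xb i; exact: le_trans h1 h2.
  rewrite !e ?measure0 // => h; apply: nab => i.
  by have := h i; rewrite !mxE lerD2r.
- by move=> n; exact: box_lty.
Qed.

End Lebesgue.
End HalfSpaceMeasure.

(** * Integrals of partial derivatives *)

Section WeakGradient.
Context {R : realType}.

Lemma coord_le_norm (N : nat) (x : 'rV[R]_N) (i : 'I_N) : `|x ord0 i| <= `|x|.
Proof.
rewrite [leRHS]mx_normrE.
exact: (le_bigmax _ (fun ij : 'I_1 * 'I_N => `|x ij.1 ij.2|) (ord0, i)).
Qed.

Lemma compact_coord_bound (N : nat) (K : set 'rV[R]_N) : compact K ->
  exists2 L : R, 0 < L & forall x, K x -> forall i, `|x ord0 i| < L.
Proof.
move=> /compact_bounded[M [_ Mb]]; exists (`|M| + 2); first exact: ltr_wpDl.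
move=> x Kx i; apply: (@le_lt_trans _ _ (`|M| + 1)); last by rewrite ltrD2l ltr1n.
apply: le_trans (coord_le_norm x i) _; apply: Mb => //.
by rewrite (le_lt_trans (ler_norm M))// ltrDl.
Qed.

Lemma compact_continuous_bound (N : nat) (K : set 'rV[R]_N) (f : 'rV[R]_N -> R) :
  compact K -> continuous f -> exists2 M : R, 0 < M & forall x, K x -> `|f x| <= M.
Proof.
move=> cK cf.
have /compact_bounded[M [_ Mb]] : compact (f @` K).
  by apply: continuous_compact cK; exact: continuous_subspaceT.
exists (`|M| + 1); first exact: ltr_wpDl.
by move=> x Kx; apply: Mb; [rewrite (le_lt_trans (ler_norm M))// ltrDl|exists x].
Qed.

(** The two difference quotients are the same function of the step; this turns directional
    derivatives into one-variable ones. *)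
Lemma is_derive_lineE (V : normedModType R) (f : V -> R) (x v : V) (t d : R) :
  is_derive t 1 (fun s : R => f (s *: v + x)) d <-> is_derive (t *: v + x) v f d.
Proof.
have E : (fun h : R => h^-1 *: (f ((h *: 1 + t) *: v + x) - f (t *: v + x))) =
         (fun h : R => h^-1 *: (f (h *: v + (t *: v + x)) - f (t *: v + x))).
  by apply/funext => h; rewrite scalerDl addrA scaler1.
split=> -[H <-].
  by apply: DeriveDef; rewrite ?/derivable ?/derive -E.
by apply: DeriveDef; rewrite ?/derivable ?/derive /= E.
Qed.

(** Mean value theorem along the line; it supplies the domination of the difference quotients. *)
Lemma derive_increment_bound (V : normedModType R) (f g : V -> R) (v x : V) (M t : R) :
  (forall y, is_derive y v f (g y)) -> (forall y, `|g y| <= M) -> 0 <= t ->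
  `|f (t *: v + x) - f x| <= M * t.
Proof.
move=> fg gM t0.
have dl (s : R) : is_derive s 1 (fun s : R => f (s *: v + x)) (g (s *: v + x)).
  exact/is_derive_lineE.
have [|c _] := @MVT_segment R _ _ 0 t t0 (fun s _ => dl s).
  by apply: derivable_within_continuous => s _; exact: (@ex_derive _ _ _ _ _ _ _ (dl s)).
rewrite scale0r add0r subr0 => ->.
by rewrite normrM (ger0_norm t0) ler_wpM2r.
Qed.

Section Lebesgue.
Context {N : nat} (mu : {measure set (Rn R N) -> \bar R}).
Hypothesis mu_leb : is_lebesgue mu.

Lemma compact_lty (K : set 'rV[R]_N) : compact K -> (mu K < +oo)%E.
Proof.
move=> cK; have [L L0 KL] := compact_coord_bound cK.
apply: le_lt_trans (box_lty mu_leb (const_mx (- L)) (const_mx L)).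
apply: le_measure; rewrite ?inE.
- exact: compact_measurable_Rn.
- exact: box_measurable.
- move=> x Kx i; rewrite !mxE; have := KL x Kx i.
  by rewrite ltr_norml => /andP[-> /ltW].
Qed.

Lemma bounded_support_integrable (f : 'rV[R]_N -> R) (a b : 'rV[R]_N) (M : R) :
  measurable_fun setT (f : Rn R N -> R) -> (forall x, `|f x| <= M) ->
  (forall x, ~ box a b x -> f x = 0) ->
  mu.-integrable setT (EFin \o (f : Rn R N -> R)).
Proof.
move=> mf fM f0.
have mB : measurable (box a b : set (Rn R N)) := box_measurable a b.
apply: (@le_integrable _ _ R mu setT measurableT _ (fun x => M%:E * (\1_(box a b : set (Rn R N)) x)%:E)%E) => //.
- exact/measurable_EFinP.
- move=> x _ /=; rewrite lee_fin normrM indicE.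
  case: (asboolP (box a b x)) => xb.
    by rewrite mem_set // normr1 mulr1 (le_trans (fM x)) ?ler_norm.
  by rewrite f0 // normr0 mulr_ge0.
- apply: integrableZl => //; apply/integrableP; split.
    exact/measurable_EFinP/measurable_indic.
  rewrite (eq_integral (fun x : Rn R N => (\1_(box a b : set (Rn R N)) x)%:E)).
    by rewrite integral_indic // setIT; exact: box_lty.
  by move=> x _ /=; rewrite ger0_norm.
Qed.

Lemma integral_translation (f : 'rV[R]_N -> R) (v : 'rV[R]_N) :
  measurable_fun setT (f : Rn R N -> R) ->
  mu.-integrable setT (EFin \o (fun x : Rn R N => f (x + v))) ->
  (\int[mu]_x (f (x + v))%:E = \int[mu]_x (f x)%:E)%E.
Proof.
move=> mf intf.
have mT := measurable_translation (R := R) v.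
transitivity (\int[pushforward mu ((fun x : 'rV[R]_N => x + v)%R : Rn R N -> Rn R N)]_x (f x)%:E)%E.
  rewrite (integral_pushforward (f := EFin \o (f : Rn R N -> R)) mT) //.
  exact/measurable_EFinP.
have E := @eq_measure_integral _ (Rn R N) R setT mu
  (pushforward mu ((fun x : 'rV[R]_N => x + v) : Rn R N -> Rn R N)) (EFin \o f).
apply: (E mT) => A mA _; exact: (lebesgue_translation mu_leb v mA).
Qed.

Lemma integral_derive_eq0 (f g : 'rV[R]_N -> R) (i : 'I_N) (K : set 'rV[R]_N) :
  continuous f -> continuous g -> (forall x, is_derive x (evec R i) f (g x)) ->
  compact K -> (forall x, ~ K x -> f x = 0) -> (forall x, ~ K x -> g x = 0) ->
  (\int[mu]_x (g x)%:E = 0)%E.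
Proof.
move=> cf cg fg cK f0 g0.
have [L L0 KL] := compact_coord_bound cK.
have [Mf Mf0 fK] := compact_continuous_bound cK cf.
have [M M0 gK] := compact_continuous_bound cK cg.
have fM x : `|f x| <= Mf.
  by case: (pselect (K x)) => [/fK//|/f0->]; rewrite normr0 ltW.
have gM x : `|g x| <= M.
  by case: (pselect (K x)) => [/gK//|/g0->]; rewrite normr0 ltW.
pose h (n : nat) : R := n.+1%:R^-1.
have h0 n : 0 < h n by rewrite invr_gt0.
have h1 n : h n <= 1 by rewrite invf_le1 // ler1n.
(* The margin 1 absorbs every shift by [h n <= 1], so one box contains the supports of all the
   quotients. *)
pose a : 'rV[R]_N := const_mx (- (L + 1)); pose b : 'rV[R]_N := const_mx (L + 1).
have Kbox (t : R) x : 0 <= t <= 1 -> ~ box a b x -> ~ K (t *: evec R i + x).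
  move=> /andP[t0 t1] nb Kx; apply: nb => j; rewrite !mxE.
  have := KL _ Kx j; rewrite !mxE ltr_norml.
  rewrite eqxx; case: (j == i); rewrite /= ?mulr1 ?mulr0; move=> /andP[? ?];
  apply/andP; split; lra.
have f0b x : ~ box a b x -> f x = 0.
  move=> nb; have := Kbox 0 x; rewrite lexx ler01 scale0r add0r => Kb.
  by apply: f0; exact: Kb.
have fT0b n x : ~ box a b x -> f (x + h n *: evec R i) = 0.
  by move=> nb; rewrite addrC; apply: f0; apply: Kbox => //; rewrite ltW //= h1.
have mf := continuous_measurable_Rn cf.
have mfT n : measurable_fun setT ((fun x => f (x + h n *: evec R i)) : Rn R N -> R).
  apply: continuous_measurable_Rn => x; apply: continuous_comp; last exact: cf.
  exact: continuous_translation.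
have intf := bounded_support_integrable mf fM f0b.
have intfT n := bounded_support_integrable (mfT n) (fun x => fM _) (fT0b n).
pose F (n : nat) (x : Rn R N) : R := (h n)^-1 * (f (x + h n *: evec R i) - f x).
have mF n : measurable_fun setT (F n).
  by apply: measurable_funM => //; apply: measurable_funB.
have F0 n : (\int[mu]_x (F n x)%:E = 0)%E.
  have -> : (fun x => (F n x)%:E) =
      (fun x => ((h n)^-1)%:E * ((f (x + h n *: evec R i)) %:E - (f x)%:E))%E.
    by apply/funext => x; rewrite -EFinB -EFinM.
  rewrite integralZl //; last exact: (integrableB measurableT (intfT n) intf).
  rewrite integralB_EFin // integral_translation // subee ?mule0 //.
  exact: integrable_fin_num.
have FM n x : `|F n x| <= M.
  rewrite /F normrM normfV (gtr0_norm (h0 n)) mulrC ler_pdivrMr //.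
  rewrite [x + _ *: _]addrC.
  exact: (@derive_increment_bound 'rV[R]_N f g (evec R i) x M (h n) fg gM (ltW (h0 n))).
have F0b n x : ~ box a b x -> F n x = 0.
  by move=> nb; rewrite /F fT0b // f0b // subr0 mulr0.
have cvgF x : F n x @[n --> \oo] --> g x.
  have [dx <-] := fg x.
  have /cvg_ex[l hl] := dx.
  have -> : 'D_(evec R i) f x = l by apply: cvg_lim hl.
  (* The derivative is a limit over the punctured neighbourhood, so the steps must avoid 0. *)
  have hn : (forall n, h n != 0) /\ h n @[n --> \oo] --> (0 : R).
    by split=> [n|]; [rewrite gt_eqF|exact: cvg_harmonic].
  move/cvgr_dnbhsP : hl => /(_ _ hn).
  apply: cvg_trans; apply: near_eq_cvg; near=> n.
  by rewrite /F /= [h n *: _ + x]addrC.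
have [|||||_ _ lim] := @dominated_convergence _ (Rn R N) R mu setT measurableT
  (fun n => EFin \o F n) (EFin \o g) (fun x => (M * \1_(box a b : set (Rn R N)) x)%:E).
- by move=> n; exact/measurable_EFinP.
- by apply/measurable_EFinP; exact: continuous_measurable_Rn.
- apply: aeW => x _ /=; apply: cvg_EFin; [exact: nearW|exact: cvgF].
- apply: (@bounded_support_integrable (fun x => M * \1_(box a b) x) a b M).
  + by apply: measurable_funM => //; apply: measurable_indic; exact: box_measurable.
  + move=> x; rewrite normrM (gtr0_norm M0) ger0_norm // indicE.
    by case: (_ \in _); rewrite ?mulr1 ?mulr0 // ltW.
  + by move=> x nb; rewrite indicE memNset // mulr0.
- apply: aeW => x n _ /=; rewrite lee_fin indicE.
  case: (asboolP (box a b x)) => xb.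
    by rewrite mem_set // mulr1; exact: FM.
  by rewrite F0b // normr0 mulr_ge0 // ltW.
have E : (fun n => \int[mu]_x (F n x)%:E)%E = cst 0%E.
  by apply/funext => n; exact: F0.
have /cvg_lim <- // : (fun n => \int[mu]_x (F n x)%:E)%E @ \oo --> (\int[mu]_x (g x)%:E)%E.
  exact: lim.
by rewrite E lim_cst.
Unshelve. all: by end_near.
Qed.
End Lebesgue.
End WeakGradient.

(** * Classical gradients are weak gradients *)

Section ClassicalGradient.
Context {R : realType} {m : nat} (mu : {measure set (Rn R m.+1) -> \bar R}).
Hypothesis mu_leb : is_lebesgue mu.

Lemma continuous_loc_integrable (f : 'rV[R]_m.+1 -> R) :
  continuous f -> loc_integrable mu f.
Proof.
move=> cf K cK _.
have [M M0 fM] := compact_continuous_bound cK cf.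
apply: (@measurable_bounded_integrable _ _ _ mu f K (compact_measurable_Rn cK)).
- exact: (compact_lty mu_leb).
- by apply: measurable_funTS; exact: continuous_measurable_Rn.
- exists M; split; first exact: num_real.
  by move=> x Mx y Ky; apply: le_trans (fM _ Ky) (ltW Mx).
Qed.

Lemma derive_eq0_off_closed (K : set 'rV[R]_m.+1) (phi : 'rV[R]_m.+1 -> R)
    (v x : 'rV[R]_m.+1) :
  closed K -> (forall y, ~ K y -> phi y = 0) -> ~ K x -> 'D_v phi x = 0.
Proof.
move=> cK phi0 nKx.
transitivity ('D_v (cst (0 : R) : 'rV[R]_m.+1 -> R) x); last exact: derive_cst.
apply: near_eq_derive.
have : nbhs x (~` K) by apply: open_nbhs_nbhs; split => //; exact: closed_openC.
by apply: filterS => y; exact: phi0.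
Qed.

Lemma integral_halfspace_supp (f : 'rV[R]_m.+1 -> R) (K : set 'rV[R]_m.+1) :
  K `<=` @halfspace R m -> (forall x, ~ K x -> f x = 0) ->
  (\int[mu]_(x in (@halfspace R m : set (Rn R m.+1))) (f x)%:E = \int[mu]_x (f x)%:E)%E.
Proof.
move=> KH f0; rewrite integral_mkcond; apply: eq_integral => x _.
rewrite /patch; case: ifPn => // /negP xH; rewrite f0 // => /KH Hx.
by apply: xH; rewrite inE.
Qed.

Lemma classical_weak_gradient (u : 'rV[R]_m.+1 -> R)
    (Du : 'rV[R]_m.+1 -> 'rV[R]_m.+1) :
  continuous u ->
  (forall i x, is_derive x (evec R i) u (Du x ord0 i)) ->
  (forall i, continuous (fun x => Du x ord0 i)) ->
  weak_gradient mu u Du.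
Proof.
move=> cu du cDu; split; first exact: continuous_loc_integrable.
split=> [i|phi [sphi [K [cK [KH phi0]]] i]].
  exact: (continuous_loc_integrable (cDu i)).
have [cphi /(_ i)[dphi cdphi]] := sphi 1%N.
have clK : closed K by apply: compact_closed cK; exact: norm_hausdorff.
have dphi0 x : ~ K x -> 'D_(evec R i) phi x = 0 by exact: derive_eq0_off_closed.
have [L L0 KL] := compact_coord_bound cK.
pose a : 'rV[R]_m.+1 := const_mx (- L); pose b : 'rV[R]_m.+1 := const_mx L.
have Kb x : ~ box a b x -> ~ K x.
  move=> nb Kx; apply: nb => j; rewrite !mxE; have := KL x Kx j.
  by rewrite ltr_norml => /andP[-> /ltW].
have int (f : 'rV[R]_m.+1 -> R) : continuous f -> (forall x, ~ K x -> f x = 0) ->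
    mu.-integrable setT (EFin \o (f : Rn R m.+1 -> R)).
  move=> cf f0; have [M M0 fM] := compact_continuous_bound cK cf.
  apply: (bounded_support_integrable mu_leb (a := a) (b := b) (M := M)).
  - exact: continuous_measurable_Rn.
  - by move=> x; case: (pselect (K x)) => [/fM//|/f0->]; rewrite normr0 ltW.
  - by move=> x /Kb /f0.
pose f1 x := u x * 'D_(evec R i) phi x.
pose f2 x := Du x ord0 i * phi x.
have cf1 : continuous f1 by move=> x; exact: (continuousM (cu x) (cdphi x)).
have cf2 : continuous f2 by move=> x; exact: (continuousM (cDu i x) (cphi x)).
have f10 x : ~ K x -> f1 x = 0 by move=> /dphi0 h; rewrite /f1 h mulr0.
have f20 x : ~ K x -> f2 x = 0 by move=> /phi0 h; rewrite /f2 h mulr0.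
rewrite (integral_halfspace_supp KH f10) (integral_halfspace_supp KH f20).
(* The integrand is the partial derivative of [u * phi], which vanishes off [K]. *)
have : (\int[mu]_x (f1 x + f2 x)%:E = 0)%E.
  apply: (integral_derive_eq0 mu_leb (f := fun x => u x * phi x) (i := i) _ _ _ cK).
  - by move=> x; exact: (continuousM (cu x) (cphi x)).
  - by move=> x; exact: (continuousD (cf1 x) (cf2 x)).
  - move=> x; rewrite /f1 /f2 [Du x ord0 i * _]mulrC.
    exact: (is_deriveM (du i x) (derivableP (dphi x))).
  - by move=> x /phi0->; rewrite mulr0.
  - by move=> x nK; rewrite f10 // f20 // addr0.
under eq_integral do rewrite EFinD.
rewrite integralD //; [|exact: int|exact: int].
(* Finiteness of both integrals lets the extended-real identity be solved for one of them. *)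
have := integrable_fin_num measurableT (int _ cf1 f10).
have := integrable_fin_num measurableT (int _ cf2 f20).
rewrite /=; case: (\int[mu]_x _)%E => // r2 _; case: (\int[mu]_x _)%E => // r1 _.
by rewrite -EFinD -EFinN => -[] /eqP; rewrite addr_eq0 => /eqP ->.
Qed.
End ClassicalGradient.

(** * From almost every pair to every pair *)

Section Transfer.
Context {R : realType}.

(** A null set cannot contain a box of positive volume. *)
Lemma ae_dense (N : nat) (mu : {measure set (Rn R N) -> \bar R}) (P : 'rV[R]_N -> Prop)
    (x : 'rV[R]_N) (e : R) :
  is_lebesgue mu -> {ae mu, forall y : Rn R N, P y} -> 0 < e ->
  exists2 y, ball x e y & P y.
Proof.
move=> mu_leb [A [mA A0 sub]] e0.
apply: contrapT => nex.
pose a : 'rV[R]_N := x - const_mx (e / 2); pose b : 'rV[R]_N := x + const_mx (e / 2).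
have bA : (box a b : set (Rn R N)) `<=` A.
  move=> y yb; apply: sub => Py; apply: nex; exists y => //.
  apply/ball_rowP => // i; have := yb i; rewrite !mxE ltr_norml => /andP[? ?].
  apply/andP; split; lra.
have : (mu (box a b) <= 0)%E.
  by rewrite -A0; apply: le_measure; rewrite ?inE //; exact: box_measurable.
rewrite mu_leb; last by move=> i; rewrite !mxE; lra.
rewrite lee_fin leNgt prodr_gt0 // => i _; rewrite !mxE; lra.
Qed.

(** A strict violation at [(x, y)] persists nearby by continuity, and every neighbourhood contains a
    pair where the inequality holds. *)
Lemma ae_ineq_everywhere (m : nat) (mu : {measure set (Rn R m.+1) -> \bar R})
    (omega : 'rV[R]_m.+1 -> 'rV[R]_m.+1 -> R) (u : 'rV[R]_m.+1 -> R) (e : R) :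
  is_lebesgue mu ->
  {within @halfspace R m `*` @halfspace R m, continuous (fun z => omega z.1 z.2)} ->
  continuous u ->
  {ae mu, forall x : Rn R m.+1, @halfspace R m x ->
    {ae mu, forall y : Rn R m.+1, @halfspace R m y ->
      `|u x - u y| <= omega x y * e}} ->
  forall x y, @halfspace R m x -> @halfspace R m y -> `|u x - u y| <= omega x y * e.
Proof.
move=> mu_leb com cu ineq x y Hx Hy.
have oH := @open_halfspace R m.
have oHH : open (@halfspace R m `*` @halfspace R m).
  rewrite openE => -[z1 z2] [/= Hz1 Hz2].
  by exists (@halfspace R m, @halfspace R m) => //; split; apply: open_nbhs_nbhs.
move: com; rewrite continuous_open_subspace // => com.
have {}com : {for (x, y), continuous (fun z => omega z.1 z.2)}.
  by apply: com; rewrite inE.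
rewrite leNgt; apply/negP => lt0.
pose F (z : 'rV[R]_m.+1 * 'rV[R]_m.+1) := `|u z.1 - u z.2| - omega z.1 z.2 * e.
have cF : {for (x, y), continuous F}.
  apply: (@continuousB _ _ _ (fun z => `|u z.1 - u z.2|) (fun z => omega z.1 z.2 * e)).
    apply: continuous_comp; last exact: norm_continuous.
    apply: (@continuousB _ _ _ (fun z => u z.1) (fun z => u z.2)).
      by apply: continuous_comp; [exact: cvg_fst|exact: cu].
    by apply: continuous_comp; [exact: cvg_snd|exact: cu].
  by apply: continuousM => //; exact: cvg_cst.
have nF : nbhs (x, y) [set z | 0 < F z].
  have : nbhs (F (x, y)) [set t | 0 < t].
    by apply: open_nbhs_nbhs; split; [exact: open_gt|rewrite /F /= subr_gt0].
  by move=> /cF.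
have nH : nbhs (x, y) (@halfspace R m `*` @halfspace R m).
  by apply: open_nbhs_nbhs; split.
have /nbhs_ballP[d /= d0 sub] :
    nbhs (x, y) ([set z | 0 < F z] `&` (@halfspace R m `*` @halfspace R m)).
  exact: filterI.
(* [x1] comes first, since the full set from which [y1] is taken depends on it. *)
have [x1 bx Hx1] := ae_dense x mu_leb ineq d0.
have Hhx1 : halfspace x1 by have [_ []] := sub (x1, y) (conj bx (ballxx y d0)).
have [y1 by1 Hy1] := ae_dense y mu_leb (Hx1 Hhx1) d0.
have [] := sub (x1, y1) (conj bx by1).
rewrite /F /= => F0 [_ Hhy1]; move: F0; rewrite subr_gt0 ltNge.
by rewrite (Hy1 Hhy1).
Qed.

End Transfer.

(** * Bumps *)

Section Bump.
Context {R : realType}.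

(** The error of the difference quotient is at most [K * |h|]; derivatives of piecewise polynomials
    thus reduce to polynomial inequalities. *)
Lemma is_derive_quadratic (F : R -> R) (x d K : R) : 0 < K ->
  (forall h, `|F (h + x) - F x - d * h| <= K * h ^+ 2) -> is_derive x (1 : R) F d.
Proof.
move=> K0 HF.
have lim : (fun h : R => h^-1 *: (F (h *: 1 + x) - F x)) h @[h --> 0^'] --> d.
  apply/cvgrPdist_le => e e0.
  near=> h.
  have hn0 : h != 0 by near: h; exact: nbhs_dnbhs_neq.
  have -> : d - h^-1 *: (F (h *: 1 + x) - F x) = - (h^-1 * (F (h + x) - F x - d * h)).
    by rewrite [h *: 1]mulr1 -[_ *: _]/(_ * _); field.
  rewrite normrN normrM normfV ler_pdivrMl ?normr_gt0 //.
  apply: le_trans (HF h) _; rewrite -real_normK ?num_real // expr2 mulrCA ler_wpM2l //.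
  rewrite mulrC -ler_pdivlMr //.
  by near: h; apply: dnbhs0_le; exact: divr_gt0.
by apply: DeriveDef; [apply/cvg_ex; exists d|exact: cvg_lim].
Unshelve. all: by end_near.
Qed.

Definition pos2 (t : R) : R := Num.max 0 t ^+ 2.

Lemma is_derive_pos2 (t : R) : is_derive t (1 : R) pos2 (2 * Num.max 0 t).
Proof.
apply: (@is_derive_quadratic _ _ _ 1) => // h; rewrite /pos2 mul1r ler_norml.
by case: (leP 0 (h + t)) => ?; case: (leP 0 t) => ?; apply/andP; split; nra.
Qed.

Lemma continuous_pos2 : continuous pos2.
Proof.
move=> t; apply: differentiable_continuous; apply/derivable1_diffP.
by have [] := is_derive_pos2 t.
Qed.

(** A cutoff from 1 on [t <= 1] to 0 on [2 <= t]; two nested truncated squares make it [C^1], the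
    regularity that [classical_weak_gradient] asks for. *)
Definition plateau (t : R) : R := pos2 (1 - pos2 (t - 1)).

Definition dplateau (t : R) : R :=
  2 * Num.max 0 (1 - pos2 (t - 1)) * - (2 * Num.max 0 (t - 1)).

Lemma plateau_eq1 (t : R) : t <= 1 -> plateau t = 1.
Proof.
move=> t1; rewrite /plateau /pos2 (max_idPl (_ : t - 1 <= 0)) ?subr_le0 //.
by rewrite expr0n /= subr0 (max_idPr _) // expr1n.
Qed.

Lemma plateau_eq0 (t : R) : 2 <= t -> plateau t = 0.
Proof.
move=> t2; rewrite /plateau /pos2 (max_idPr (_ : 0 <= t - 1)); last lra.
by rewrite (max_idPl _) ?expr0n //=; nra.
Qed.

Lemma dplateau_eq0 (t : R) : ~~ (1 < t < 2) -> dplateau t = 0.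
Proof.
rewrite negb_and -!leNgt => /orP[t1|t2]; rewrite /dplateau /pos2.
  by rewrite (max_idPl (_ : t - 1 <= 0)) ?mulr0 ?oppr0 ?mulr0 //; lra.
rewrite (max_idPr (_ : 0 <= t - 1)); last lra.
by rewrite (max_idPl _) ?mulr0 ?mul0r //; nra.
Qed.

(** For [1 < t < 2] both truncated factors lie in the unit interval, leaving [2 * 2]. *)
Lemma dplateau_bound (t : R) : `|dplateau t| <= 4.
Proof.
case: (boolP (1 < t < 2)) => [/andP[t1 t2]|/dplateau_eq0 ->]; last by rewrite normr0.
rewrite /dplateau /pos2 (max_idPr (_ : 0 <= t - 1)); last lra.
rewrite (max_idPr _); last by nra.
have a0 : 0 <= 1 - (t - 1) ^+ 2 <= 1 by apply/andP; split; nra.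
have b0 : 0 <= t - 1 <= 1 by apply/andP; split; lra.
move: a0 b0; set a := 1 - _; set b := t - 1 => /andP[? ?] /andP[? ?].
by rewrite ler_norml; apply/andP; split; nra.
Qed.

Lemma is_derive_plateau (t : R) : is_derive t (1 : R) plateau (dplateau t).
Proof.
have d1 : is_derive t (1 : R) (fun s => s - 1) 1.
  by apply: (@is_derive_quadratic _ _ _ 1) => // h; rewrite mul1r ler_norml; apply/andP; split; nra.
have d2 : is_derive (pos2 (t - 1)) (1 : R) (fun s => 1 - s) (-1).
  by apply: (@is_derive_quadratic _ _ _ 1) => // h; rewrite mul1r ler_norml; apply/andP; split; nra.
have d3 := @is_derive1_comp R pos2 (fun s => s - 1) t _ _ (is_derive_pos2 (t - 1)) d1.
have d4 := @is_derive1_comp R (fun s => 1 - s) (fun s => pos2 (s - 1)) t _ _ d2 d3.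
have := @is_derive1_comp R pos2 (fun s => 1 - pos2 (s - 1)) t _ _ (is_derive_pos2 _) d4.
by rewrite /dplateau mulr1 mulN1r.
Qed.

Lemma continuous_plateau : continuous plateau.
Proof.
move=> t; apply: differentiable_continuous; apply/derivable1_diffP.
by have [] := is_derive_plateau t.
Qed.

Lemma continuous_dplateau : continuous dplateau.
Proof.
have cm : continuous (fun t : R => Num.max 0 t).
  by move=> t; apply: continuous_max; [exact: cvg_cst|exact: cvg_id].
have cs (a : R) : continuous (fun t : R => t - a).
  by move=> t; apply: cvgB; [exact: cvg_id|exact: cvg_cst].
have c1 : continuous (fun t : R => pos2 (t - 1)).
  move=> t.
  exact: (@continuous_comp _ _ _ (fun t : R => t - 1) pos2 t (cs 1 t) (@continuous_pos2 _)).
have c2 : continuous (fun t : R => 1 - pos2 (t - 1)).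
  by move=> t; apply: cvgB; [exact: cvg_cst|exact: c1].
have c3 : continuous (fun t : R => Num.max 0 (1 - pos2 (t - 1))).
  move=> t; exact: (@continuous_comp _ _ _ (fun t : R => 1 - pos2 (t - 1)) (fun t : R => Num.max 0 t) t (c2 t) (cm _)).
have c4 : continuous (fun t : R => Num.max 0 (t - 1)).
  move=> t; exact: (@continuous_comp _ _ _ (fun t : R => t - 1) (fun t : R => Num.max 0 t) t (cs 1 t) (cm _)).
move=> t; apply: cvgM; first by apply: cvgM; [exact: cvg_cst|exact: c3].
by apply: cvgN; apply: cvgM; [exact: cvg_cst|exact: c4].
Qed.
End Bump.

Lemma continuous_bigsum {R : realType} (T : topologicalType) (I : Type) (r : seq I)
    (f : I -> T -> R) :
  (forall i, continuous (f i)) -> continuous (fun x => \sum_(i <- r) f i x).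
Proof.
move=> cf; apply: (@continuous_big R I +%R 0 xpredT) => //.
exact: add_continuous.
Qed.

(** * Radial bumps and their sums over dyadic radii *)

Section Tower.
Context {R : realType} {N : nat}.
Implicit Types c x y z : 'rV[R]_N.

(** The square of the Euclidean distance: a polynomial, hence differentiable also at the center
    [c]. *)
Definition sqdist c z : R := \sum_(i < N) (z ord0 i - c ord0 i) ^+ 2.

Lemma sqdist_ge0 c z : 0 <= sqdist c z.
Proof. by apply: sumr_ge0 => i _; exact: sqr_ge0. Qed.

Lemma sqdistC c z : sqdist c z = sqdist z c.
Proof. by apply: eq_bigr => i _; rewrite -sqrrN opprB. Qed.

Lemma enorm_sqdist x y : enorm (x - y) = Num.sqrt (sqdist y x).
Proof. by congr Num.sqrt; apply: eq_bigr => i _; rewrite !mxE. Qed.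

Lemma coord_sqdist c z i : (z ord0 i - c ord0 i) ^+ 2 <= sqdist c z.
Proof. by rewrite /sqdist (bigD1 i) //= lerDl; apply: sumr_ge0 => j _; exact: sqr_ge0. Qed.

Lemma continuous_sqdist c : continuous (sqdist c).
Proof.
apply: continuous_bigsum => i z.
have h : (fun x : 'rV[R]_N => x ord0 i - c ord0 i) y @[y --> z] --> z ord0 i - c ord0 i.
  exact: (cvgB (@row_coord_continuous R N i z) (cvg_cst _)).
exact: (cvgM h h).
Qed.

Lemma sqdist_line c z i (h : R) :
  sqdist c (h *: evec R i + z) = sqdist c z + 2 * h * (z ord0 i - c ord0 i) + h ^+ 2.
Proof.
rewrite /sqdist (bigD1 i) //= [in RHS](bigD1 i) //= !mxE !eqxx /=.
rewrite (eq_bigr (fun j => (z ord0 j - c ord0 j) ^+ 2)); first by ring.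
by move=> j ji; rewrite !mxE (negbTE ji) /= ?andbF mulr0 add0r.
Qed.

(** Equal to 1 within radius [s] and to 0 beyond radius [sqrt 2 * s], because the cutoff acts on the
    squared distance. *)
Definition bump c (s : R) z : R := plateau (sqdist c z / s ^+ 2).

Definition gbump c (s : R) z : 'rV[R]_N :=
  (dplateau (sqdist c z / s ^+ 2) * (2 / s ^+ 2)) *: (z - c).

Lemma is_derive_bump c (s : R) z i : 0 < s ->
  is_derive z (evec R i) (bump c s) (gbump c s z ord0 i).
Proof.
move=> s0; have s20 : 0 < s ^+ 2 by exact: exprn_gt0.
rewrite -[z in is_derive z]add0r -[X in X + z](scale0r (evec R i)).
apply/is_derive_lineE.
pose g (h : R) := (sqdist c z + 2 * h * (z ord0 i - c ord0 i) + h ^+ 2) / s ^+ 2.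
(* Along the line the squared distance is quadratic, so the remainder is exactly
   [h ^+ 2 / s ^+ 2]. *)
have dg : is_derive (0 : R) (1 : R) g (2 * (z ord0 i - c ord0 i) / s ^+ 2).
  apply: (@is_derive_quadratic _ _ _ _ (s ^- 2)); first by rewrite invr_gt0.
  move=> h; rewrite le_eqVlt; apply/orP; left; apply/eqP.
  rewrite (_ : _ - _ = s ^- 2 * h ^+ 2).
    by rewrite ger0_norm // mulr_ge0 ?sqr_ge0 // invr_ge0 ltW.
  by rewrite /g addr0; field; rewrite gt_eqF.
have -> : (fun h : R => bump c s (h *: evec R i + z)) = (fun h => plateau (g h)).
  by apply/funext => h; rewrite /bump sqdist_line.
have := @is_derive1_comp R plateau g 0 _ _ (is_derive_plateau (g 0)) dg.
rewrite /gbump /g !mxE mulr0 mul0r expr0n /= !addr0.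
move=> H; apply: (is_derive_eq H).
by field; rewrite gt_eqF.
Qed.

Lemma continuous_bump c (s : R) : continuous (bump c s).
Proof.
have h : continuous (fun z => sqdist c z / s ^+ 2).
  by move=> z; exact: (cvgM (@continuous_sqdist c z) (cvg_cst _)).
by move=> z; exact: (@continuous_comp _ _ _ _ plateau z (h z) (@continuous_plateau _ _)).
Qed.

Lemma continuous_gbump c (s : R) i : continuous (fun z => gbump c s z ord0 i).
Proof.
have h : continuous (fun z => sqdist c z / s ^+ 2).
  by move=> z; exact: (cvgM (@continuous_sqdist c z) (cvg_cst _)).
have h' z := @continuous_comp _ _ _ _ dplateau z (h z) (@continuous_dplateau _ _).
have -> : (fun z => gbump c s z ord0 i) =
    (fun z => (dplateau (sqdist c z / s ^+ 2) * (2 / s ^+ 2)) * (z ord0 i - c ord0 i)).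
  by apply/funext => z; rewrite !mxE.
move=> z; apply: (cvgM (cvgM (h' z) (cvg_cst _))).
exact: (cvgB (@row_coord_continuous R N i z) (cvg_cst _)).
Qed.

Lemma enormZ (a : R) (v : 'rV[R]_N) : enorm (a *: v) = `|a| * enorm v.
Proof.
rewrite /enorm -sqrtr_sqr -sqrtrM ?sqr_ge0 // mulr_sumr.
by congr Num.sqrt; apply: eq_bigr => i _; rewrite mxE exprMn.
Qed.

Lemma enorm0 : enorm (0 : 'rV[R]_N) = 0.
Proof. by rewrite -(scale0r (0 : 'rV[R]_N)) enormZ normr0 mul0r. Qed.

Lemma gbump_eq0 c (s : R) z : 0 < s ->
  ~~ (s ^+ 2 < sqdist c z < 2 * s ^+ 2) -> gbump c s z = 0.
Proof.
move=> s0 h; have s20 : 0 < s ^+ 2 by exact: exprn_gt0.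
rewrite /gbump dplateau_eq0 ?mul0r ?scale0r //; apply: contra h.
by rewrite ltr_pdivlMr // ltr_pdivrMr // mul1r.
Qed.

(** On the shell the distance to [c] is at most [3 / 2 * s]; with [dplateau] bounded by 4 this gives
    [4 * (2 / s ^+ 2) * (3 / 2 * s)]. *)
Lemma enorm_gbump c (s : R) z : 0 < s -> enorm (gbump c s z) <= 12 / s.
Proof.
move=> s0; have s20 : 0 < s ^+ 2 by exact: exprn_gt0.
case: (boolP (s ^+ 2 < sqdist c z < 2 * s ^+ 2)) => [/andP[_ h]|h]; last first.
  by rewrite gbump_eq0 // enorm0 divr_ge0 // ltW.
rewrite enormZ enorm_sqdist normrM.
have d0 := dplateau_bound (sqdist c z / s ^+ 2).
have q : Num.sqrt (sqdist c z) <= 3 / 2 * s.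
  rewrite -(ger0_norm (_ : 0 <= 3 / 2 * s)); last by rewrite mulr_ge0 ?divr_ge0 // ltW.
  by rewrite -sqrtr_sqr ler_wsqrtr //; nra.
have -> : 12 / s = 4 * (2 / s ^+ 2) * (3 / 2 * s) :> R by field; rewrite gt_eqF.
rewrite (gtr0_norm (_ : 0 < 2 / s ^+ 2)) ?divr_gt0 //.
apply: ler_pM => //; first by rewrite mulr_ge0 // ltW // divr_gt0.
by rewrite ler_wpM2r // ltW // divr_gt0.
Qed.

(** A discrete logarithm: at distance [s * 2 ^+ j] from [c] it equals [n - j] for [j <= n]. With
    [n = 1] it is a single bump. *)
Definition tower c (s : R) (n : nat) z : R := \sum_(k < n) bump c (s * 2 ^+ k) z.

Definition gtower c (s : R) (n : nat) z : 'rV[R]_N := \sum_(k < n) gbump c (s * 2 ^+ k) z.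

Lemma scale_gt0 (s : R) (k : nat) : 0 < s -> 0 < s * 2 ^+ k.
Proof. by move=> s0; rewrite mulr_gt0 // exprn_gt0. Qed.

Lemma continuous_tower c (s : R) n : continuous (tower c s n).
Proof. by apply: continuous_bigsum => k; exact: continuous_bump. Qed.

Lemma continuous_gtower c (s : R) n i : continuous (fun z => gtower c s n z ord0 i).
Proof.
have -> : (fun z => gtower c s n z ord0 i) =
    (fun z => \sum_(k < n) gbump c (s * 2 ^+ k) z ord0 i).
  by apply/funext => z; rewrite summxE.
by apply: continuous_bigsum => k; exact: continuous_gbump.
Qed.

Lemma is_derive_tower c (s : R) n z i : 0 < s ->
  is_derive z (evec R i) (tower c s n) (gtower c s n z ord0 i).
Proof.
move=> s0; rewrite /gtower summxE.
have -> : tower c s n = \sum_(k < n) bump c (s * 2 ^+ k).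
  by apply/funext => y; rewrite fct_sumE.
by apply: is_derive_sum => k; apply: is_derive_bump; exact: scale_gt0.
Qed.

Lemma tower_near c (s : R) n z : 0 < s -> sqdist c z <= s ^+ 2 -> tower c s n z = n%:R.
Proof.
move=> s0 h; rewrite /tower (eq_bigr (fun=> 1)).
  by rewrite sumr_const card_ord.
move=> k _; rewrite /bump plateau_eq1 // ler_pdivrMr ?exprn_gt0 ?scale_gt0 //.
rewrite mul1r (le_trans h) // lerXn2r ?nnegrE //; [exact: ltW|exact/ltW/scale_gt0|].
by rewrite ler_pMr // exprn_ege1 // ler1n.
Qed.

Lemma tower_far c (s : R) n z : 0 < s ->
  2 * (s * 2 ^+ n.-1) ^+ 2 <= sqdist c z -> tower c s n z = 0.
Proof.
move=> s0 h; rewrite /tower big1 // => k _.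
rewrite /bump plateau_eq0 // ler_pdivlMr ?exprn_gt0 ?scale_gt0 //.
apply: le_trans h; rewrite ler_pM2l // lerXn2r ?nnegrE //; [exact/ltW/scale_gt0..|].
rewrite ler_pM2l // ler_weXn2l ?ler1n //.
by rewrite -ltnS (ltn_predK (ltn_ord k)).
Qed.

(* The shells [s_k^2 < sqdist < 2 s_k^2] are disjoint since the s_k double. *)
Lemma gtower_single c (s : R) n z : 0 < s ->
  gtower c s n z = 0 \/
  exists2 k : 'I_n, sqdist c z <= 2 * (s * 2 ^+ k) ^+ 2
    & gtower c s n z = gbump c (s * 2 ^+ k) z.
Proof.
move=> s0.
case: (pselect (exists k : 'I_n,
    (s * 2 ^+ k) ^+ 2 < sqdist c z < 2 * (s * 2 ^+ k) ^+ 2)) => [[k hk]|nk]; last first.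
  left; rewrite /gtower big1 // => k _; rewrite gbump_eq0 ?scale_gt0 //.
  by apply/negP => h; apply: nk; exists k.
right; exists k; first by have /andP[_ /ltW] := hk.
rewrite /gtower (bigD1 k) //= big1 ?addr0 // => l lk.
rewrite gbump_eq0 ?scale_gt0 //; apply/negP => hl.
have key (i j : nat) : (i < j)%N -> (s * 2 ^+ j) ^+ 2 < sqdist c z ->
    sqdist c z < 2 * (s * 2 ^+ i) ^+ 2 -> False.
  move=> ij h1 h2.
  have : s * 2 ^+ i * 2 <= s * 2 ^+ j.
    by rewrite -mulrA -exprSr ler_pM2l // ler_weXn2l // ler1n.
  have := scale_gt0 i s0; move: h1 h2.
  set A := s * 2 ^+ i; set B := s * 2 ^+ j; move=> ? ? ? ?; nra.
move: hk hl => /andP[? ?] /andP[? ?].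
by have := lk; rewrite neq_ltn => /orP[] /key; apply.
Qed.

End Tower.

(** * Energy estimates *)

Section Energy.
Context {R : realType} {m : nat} (mu : {measure set (Rn R m.+1) -> \bar R}).
Hypothesis mu_leb : is_lebesgue mu.
Let V := 'rV[R]_m.+1.
Let T := Rn R m.+1.

(** The closed ball of radius [sqrt 2 * s], the outer radius of [bump c s]. *)
Definition hball (c : V) (s : R) : set V := [set z | sqdist c z <= 2 * s ^+ 2].

Lemma hball_measurable (c : V) (s : R) : measurable (hball c s : set T).
Proof.
apply: closed_measurable_Rn.
apply: (@closed_comp _ _ (sqdist c) [set t | t <= 2 * s ^+ 2]).
  by move=> z _; exact: continuous_sqdist.
exact: closed_le.
Qed.

Lemma halfspace_measurable : measurable (@halfspace R m : set T).
Proof. by apply: open_measurable_Rn; exact: open_halfspace. Qed.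

Lemma lastc_powR_measurable (gamma : R) :
  measurable_fun setT (fun z : T => (lastc z) `^ gamma).
Proof.
apply: (measurableT_comp (measurable_powR gamma)).
by apply: continuous_measurable_Rn; exact: row_coord_continuous.
Qed.

Lemma enorm_measurable (g : V -> V) :
  (forall i, continuous (fun z => g z ord0 i)) ->
  measurable_fun setT (fun z : T => enorm (g z)).
Proof.
move=> cg; apply: continuous_measurable_Rn => z.
apply: (@continuous_comp _ _ _ (fun z => \sum_(i < m.+1) (g z ord0 i) ^+ 2) Num.sqrt).
  apply: continuous_bigsum => i y; exact: (cvgM (cg i y) (cg i y)).
exact: sqrt_continuous.
Qed.

(** At most one of the gradients is nonzero at each point, so the integrand is bounded by a sum over
    [k] without cross terms. Each term is at most the p-th power of [12 / (s * 2 ^+ k)] times the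
    weight of a ball, and there the powers of [s * 2 ^+ k] cancel. *)
Lemma wenergy_tower (p gamma W s : R) (c : V) (n : nat) :
  0 < p -> 0 < s ->
  (forall k, (k < n)%N ->
    (\int[mu]_(z in (@halfspace R m `&` hball c (s * 2 ^+ k) : set T))
       ((lastc z) `^ gamma)%:E <= (W * (s * 2 ^+ k) `^ p)%:E)%E) ->
  (wenergy mu p gamma (gtower c s n) <= (n%:R * (12 `^ p * W))%:E)%E.
Proof.
move=> p0 s0 hW; rewrite /wenergy.
have mH := halfspace_measurable.
pose a (k : 'I_n) : R := (12 / (s * 2 ^+ k)) `^ p.
pose w (z : T) : R := (lastc z) `^ gamma.
have mw : measurable_fun setT w := lastc_powR_measurable gamma.
pose B (k : 'I_n) : set T := hball c (s * 2 ^+ k).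
have mB k : measurable (B k) := hball_measurable c (s * 2 ^+ k).
pose F (k : 'I_n) (z : T) : \bar R := ((a k)%:E * (w z * \1_(B k) z)%:E)%E.
have mwB k : measurable_fun setT (fun z => w z * \1_(B k) z).
  by apply: measurable_funM => //; exact: measurable_indic.
have mF k : measurable_fun (@halfspace R m : set T) (F k).
  apply: measurable_funTS; apply/measurable_EFinP; exact: measurable_funM.
have wB0 k z : 0 <= w z * \1_(B k) z by rewrite mulr_ge0 // powR_ge0.
have F0 k z : (0 <= F k z)%E by rewrite /F -EFinM lee_fin mulr_ge0 // powR_ge0.
apply: (@le_trans _ _ (\int[mu]_(z in (@halfspace R m : set T)) \sum_(k < n) F k z)%E).
  apply: ge0_le_integral => //.
  - by move=> z _; rewrite lee_fin mulr_ge0 // powR_ge0.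
  - apply: measurable_funTS; apply/measurable_EFinP; apply: measurable_funM => //.
    apply: (measurableT_comp (measurable_powR p)); apply: enorm_measurable => i.
    exact: continuous_gtower.
  - by apply: emeasurable_sum => k; exact: mF.
  - move=> z _; case: (gtower_single c n z s0) => [->|[k hk ->]].
      rewrite enorm0 powR0 ?gt_eqF // mul0r.
      by apply: sume_ge0 => k _; exact: F0.
    rewrite (bigD1 k) //= -[leLHS]adde0; apply: leeD; last first.
      by apply: sume_ge0 => l _; exact: F0.
    rewrite /F indicE mem_set // mulr1 -EFinM lee_fin ler_wpM2r ?powR_ge0 //.
    apply: ge0_ler_powR; rewrite ?nnegrE ?sqrtr_ge0 ?(ltW p0) //.
      by rewrite divr_ge0 // ltW // scale_gt0.
    by apply: enorm_gbump; exact: scale_gt0.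
rewrite ge0_integral_sum //.
rewrite -[n in n%:R]card_ord mulr_natl -sumr_const -sumEFin.
apply: lee_sum => k _.
rewrite ge0_integralZl //; last by rewrite lee_fin powR_ge0.
  rewrite (eq_integral ((fun z => (w z)%:E) \_ (B k))); last first.
    move=> z _; rewrite /patch indicE.
    by case: ifP => _; rewrite ?mulr1 ?mulr0.
  rewrite -integral_mkcondr.
  apply: (@le_trans _ _ ((a k)%:E * (W * (s * 2 ^+ k) `^ p)%:E)%E).
    by apply: lee_wpmul2l; [rewrite lee_fin powR_ge0|exact: hW].
  have sk := scale_gt0 k s0.
  have E : 12 `^ p = a k * (s * 2 ^+ k) `^ p.
    by rewrite -powRM ?divr_ge0 ?(ltW sk) // divfK // gt_eqF.
  by rewrite -EFinM lee_fin E le_eqVlt; apply/orP; left; apply/eqP; ring.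
- by apply: measurable_funTS; apply/measurable_EFinP.
- by move=> z _; rewrite lee_fin; exact: wB0.
Qed.

(** The ratio [t / a] lies between [1 / 2] and 2; a negative exponent exchanges the roles of [t] and
    [a]. *)
Lemma powR_dyadic (t a gamma : R) : 0 < a -> a / 2 <= t <= 2 * a ->
  t `^ gamma <= 2 `^ `|gamma| * a `^ gamma.
Proof.
move=> a0 /andP[h1 h2].
have t0 : 0 < t by apply: lt_le_trans h1; exact: divr_gt0.
case: (leP 0 gamma) => g0.
  rewrite ger0_norm // -powRM ?(ltW a0) //.
  by apply: ge0_ler_powR; rewrite ?nnegrE // ltW // mulr_gt0.
rewrite ltr0_norm // -[gamma in t `^ gamma]opprK -[gamma in a `^ gamma]opprK !(powRN _ (- gamma)).
have A0 : 0 < a `^ (- gamma) by exact: powR_gt0.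
have T0 : 0 < t `^ (- gamma) by exact: powR_gt0.
rewrite ler_pdivlMr // mulrC ler_pdivrMr // -powRM ?(ltW t0) //.
by apply: ge0_ler_powR; rewrite ?nnegrE; lra.
Qed.

Lemma hball_coord (c z : V) (s : R) i : 0 < s -> hball c s z ->
  `|z ord0 i - c ord0 i| < 2 * s.
Proof.
move=> s0 h; have := le_trans (coord_sqdist c z i) h.
have s2 : 0 <= 2 * s by lra.
set d := _ - _ => hd; rewrite -ltr_sqr ?nnegrE //.
by rewrite real_normK ?num_real // (le_lt_trans hd) //; nra.
Qed.

(** Heights in the ball differ from [lastc c] by less than [2 * s], at most half of it, so the
    weight is comparable to its value at [c]; the ball fits in a cube of side [4 * s]. *)
Lemma weight_interior (gamma s : R) (c : V) : 0 < s -> 4 * s <= lastc c ->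
  (\int[mu]_(z in (@halfspace R m `&` hball c s : set T)) ((lastc z) `^ gamma)%:E
    <= (2 `^ `|gamma| * (lastc c) `^ gamma * (4 * s) ^+ m.+1)%:E)%E.
Proof.
move=> s0 sc.
pose a : V := c - const_mx (2 * s); pose b : V := c + const_mx (2 * s).
have c0 : 0 < lastc c by lra.
have mHB : measurable (@halfspace R m `&` hball c s : set T).
  by apply: measurableI; [exact: halfspace_measurable|exact: hball_measurable].
apply: (@le_trans _ _ (\int[mu]_(z in (@halfspace R m `&` hball c s : set T))
   (2 `^ `|gamma| * (lastc c) `^ gamma)%:E)%E).
  apply: ge0_le_integral => //.
  - by move=> z _; rewrite lee_fin powR_ge0.
  - by apply: measurable_funTS; apply/measurable_EFinP; exact: lastc_powR_measurable.
  - move=> z [_ hz]; rewrite lee_fin; apply: powR_dyadic => //.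
    have := hball_coord ord_max s0 hz; rewrite ltr_norml -!/(lastc _) => /andP[? ?].
    by apply/andP; split; lra.
rewrite integral_cst //= [leRHS]EFinM; apply: lee_wpmul2l.
  by rewrite lee_fin mulr_ge0 // powR_ge0.
have -> : ((4 * s) ^+ m.+1)%:E = mu (box a b).
  rewrite mu_leb; last by move=> i; rewrite !mxE; lra.
  rewrite (eq_bigr (fun=> 4 * s)); first by rewrite prodr_const card_ord.
  by move=> i _; rewrite !mxE; ring.
apply: le_measure; rewrite ?inE //; first exact: box_measurable.
move=> z [_ hz] i; rewrite !mxE.
by have := hball_coord i s0 hz; rewrite ltr_norml => /andP[? ?]; apply/andP; split; lra.
Qed.

End Energy.

(** * Weight of balls centered on the boundary *)

Section Boundary.
Context {R : realType} {m : nat} (mu : {measure set (Rn R m.+1) -> \bar R}).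
Hypothesis mu_leb : is_lebesgue mu.
Let V := 'rV[R]_m.+1.
Let T := Rn R m.+1.

Lemma dyadic_layer (D t : R) : 0 < t -> t <= D ->
  exists j : nat, D / 2 ^+ j / 2 < t <= D / 2 ^+ j.
Proof.
move=> t0 tD.
have ex : exists j : nat, D / 2 ^+ j / 2 < t.
  exists (Num.bound (D / t)); have := upper_nthrootP (leqnn (Num.bound (D / t))).
  set i := Num.bound _; set x := (2 ^+ i : R); have x0 : 0 < x by exact: exprn_gt0.
  rewrite ltr_pdivrMr // => h; rewrite !ltr_pdivrMr //; nra.
(* Minimality of the index gives the upper bound; for index 0 it is [t <= D]. *)
exists (ex_minn ex); case: ex_minnP => -[|j] h1 h2; rewrite h1 /=.
  by rewrite expr0 divr1.
rewrite leNgt; apply/negP => h; have := h2 j; rewrite ltnn => h3.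
suff /h3 : D / 2 ^+ j / 2 < t by [].
by move: h; rewrite exprSr invfM mulrA.
Qed.

Lemma geometric_nneseries_le (A q : R) : 0 <= A -> 0 <= q -> q < 1 ->
  (\sum_(0 <= j <oo) (A * q ^+ j)%:E <= (A / (1 - q))%:E)%E.
Proof.
move=> A0 q0 q1.
apply: lime_le.
  by apply: is_cvg_nneseries => n _ _; rewrite lee_fin mulr_ge0 // exprn_ge0.
apply: nearW => n; rewrite sumEFin lee_fin.
have := @geometric_seriesE R A q; rewrite lt_eqF // => /(_ erefl) /(congr1 (fun f => f n)).
rewrite /series /= => ->; rewrite ler_wpM2r ?invr_ge0 ?subr_ge0 ?(ltW q1) //.
by rewrite ler_piMr // gerBl exprn_ge0.
Qed.

(** Heights in the [j]-th dyadic interval below [2 * s], other coordinates within [2 * s] of [c];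
    being a box, it has a measure given by [is_lebesgue]. *)
Definition layer (c : V) (s : R) (j : nat) : set V :=
  box (\row_i (if i == ord_max then 2 * s / 2 ^+ j / 2 else c ord0 i - 2 * s))
      (\row_i (if i == ord_max then 2 * s / 2 ^+ j else c ord0 i + 2 * s)).

Lemma lebesgue_layer (c : V) (s : R) (j : nat) : 0 < s ->
  mu (layer c s j) = (2 * s / 2 ^+ j / 2 * (4 * s) ^+ m)%:E.
Proof.
move=> s0.
have t0 : 0 < 2 * s / 2 ^+ j by rewrite divr_gt0 ?mulr_gt0 // exprn_gt0.
rewrite mu_leb; last by move=> i; rewrite !mxE; case: (i == _); lra.
congr (_%:E); rewrite (bigD1 ord_max) //= !mxE !eqxx; congr (_ * _); first lra.
rewrite (eq_bigr (fun=> 4 * s)).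
  by rewrite prodr_const (eq_card (B := predC1 ord_max)) // cardC1 card_ord.
by move=> i /negbTE h; rewrite !mxE h; ring.
Qed.

Lemma hball_layer (c z : V) (s : R) : 0 < s -> lastc c = 0 ->
  halfspace z -> hball c s z -> exists j, layer c s j z.
Proof.
move=> s0 c0 Hz hz.
have zD : lastc z <= 2 * s.
  have := hball_coord ord_max s0 hz; rewrite -!/(lastc _) c0 subr0 ltr_norml.
  by move=> /andP[_ /ltW].
have [j hj] := dyadic_layer Hz zD; exists j => i; rewrite !mxE.
case: eqVneq => [->|_]; first exact: hj.
by have := hball_coord i s0 hz; rewrite ltr_norml => /andP[? ?]; apply/andP; split; lra.
Qed.

(** On layer [j] the height is comparable to [t j] and the measure proportional to [t j * s ^+ m],
    so the layers contribute a geometric series of ratio 2 to the power [- (1 + gamma)], convergent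
    because [-1 < gamma]. *)
Lemma weight_boundary (gamma s : R) (c : V) : -1 < gamma -> 0 < s -> lastc c = 0 ->
  (\int[mu]_(z in (@halfspace R m `&` hball c s : set T)) ((lastc z) `^ gamma)%:E
    <= (2 `^ `|gamma| * (4 * s) ^+ m / 2 * (2 * s) `^ (1 + gamma)
          / (1 - 2^-1 `^ (1 + gamma)))%:E)%E.
Proof.
move=> g1 s0 c0.
have e0 : 0 < 1 + gamma by lra.
set HB : set T := _ `&` _.
have mHB : measurable HB.
  by apply: measurableI; [exact: halfspace_measurable|exact: hball_measurable].
pose t (j : nat) : R := 2 * s / 2 ^+ j.
have t0 j : 0 < t j by rewrite divr_gt0 ?mulr_gt0 // exprn_gt0.
pose L (j : nat) : set T := layer c s j.
have mL j : measurable (L j) by exact: box_measurable.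
pose K (j : nat) : R := 2 `^ `|gamma| * t j `^ gamma.
have K0 j : 0 <= K j by rewrite mulr_ge0 // powR_ge0.
pose G (j : nat) (z : T) : \bar R := ((K j)%:E * (\1_(L j) z)%:E)%E.
have G0 j z : (0 <= G j z)%E by rewrite /G -EFinM lee_fin mulr_ge0.
have mI j : measurable_fun HB (fun z => (\1_(L j) z)%:E : \bar R).
  by apply: measurable_funTS; apply/measurable_EFinP; exact: measurable_indic.
have mG j : measurable_fun HB (G j).
  by apply: measurable_funeM; exact: mI.
apply: (@le_trans _ _ (\int[mu]_(z in HB) \sum_(0 <= j <oo) G j z)%E).
  apply: ge0_le_integral => //.
  - by move=> z _; rewrite lee_fin powR_ge0.
  - by apply: measurable_funTS; apply/measurable_EFinP; exact: lastc_powR_measurable.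
  - by apply: (ge0_emeasurable_sum (P := xpredT)).
  - move=> z [Hz hz]; have [j hj] := hball_layer s0 c0 Hz hz.
    apply: (@le_trans _ _ (G j z)).
      rewrite /G indicE mem_set // mule1 lee_fin; apply: powR_dyadic => //.
      have := hj ord_max; rewrite !mxE eqxx -/(t j) -/(lastc z) => /andP[/ltW -> h] /=.
      by apply: le_trans h _; have := t0 j; lra.
    (* The partial sum up to and including index [j] already contains [G j z]. *)
    apply: le_trans (nneseries_lim_ge (m := 0%N) (P := xpredT) j.+1 _); last by [].
    rewrite big_nat_recr //= -[leLHS]add0e; apply: leeD => //.
    by apply: sume_ge0 => l _; exact: G0.
rewrite integral_nneseries //.
set A := 2 `^ `|gamma| * (4 * s) ^+ m / 2 * (2 * s) `^ (1 + gamma).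
set q := 2^-1 `^ (1 + gamma).
have A0 : 0 <= A.
  by rewrite /A !mulr_ge0 ?powR_ge0 ?invr_ge0 // exprn_ge0 // mulr_ge0 // ltW.
have q1 : q < 1.
  have E1 : 1 `^ (1 + gamma) = 1 :> R by rewrite powR1.
  rewrite /q -[ltRHS]E1.
  by apply: gt0_ltr_powR; rewrite ?nnegrE ?invr_ge0 // invf_lt1 // ltr1n.
apply: le_trans (geometric_nneseries_le A0 (powR_ge0 _ _) q1).
apply: lee_nneseries => [j _ _|j _]; first by apply: integral_ge0.
rewrite ge0_integralZl ?lee_fin //.
rewrite integral_indic //.
apply: (@le_trans _ _ ((K j)%:E * mu (L j))%E).
    by apply: lee_wpmul2l; rewrite ?lee_fin // le_measure ?inE //; exact: measurableI.
  rewrite lebesgue_layer // -/(t j) -EFinM lee_fin le_eqVlt; apply/orP; left; apply/eqP.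
  rewrite /K /A /q.
  have E : t j * t j `^ gamma = (2 * s) `^ (1 + gamma) * (2^-1 `^ (1 + gamma)) ^+ j.
    rewrite -powR_mulrn ?powR_ge0 // powRAC powR_mulrn ?invr_ge0 // exprVn.
    rewrite -powRM ?invr_ge0 ?exprn_ge0 ?mulr_ge0 ?(ltW s0) // -/(t j).
    by rewrite -(mulr_powRB1 (ltW (t0 j)) e0) [1 + gamma]addrC addrK.
  by rewrite -[RHS]mulrA -E; ring.
Qed.

End Boundary.

(** * Lower bounds for the modulus *)

Lemma lnMp {R : realType} (a b : R) : 0 < a -> 0 < b -> ln (a * b) = ln a + ln b.
Proof. by move=> a0 b0; rewrite lnM. Qed.

Lemma ln_divp {R : realType} (a b : R) : 0 < a -> 0 < b -> ln (a / b) = ln a - ln b.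
Proof. by move=> a0 b0; rewrite ln_div. Qed.

Section Modulus.
Context {R : realType} {m : nat}.
Let V := 'rV[R]_m.+1.

(** Bundles the hypotheses on [omega], so that each test function can be treated in a lemma of its
    own. *)
Definition modulus (mu : {measure set (Rn R m.+1) -> \bar R}) (p gamma : R)
    (omega : V -> V -> R) : Prop :=
  [/\ {within @halfspace R m `*` @halfspace R m, continuous (fun z => omega z.1 z.2)},
      (forall x y, @halfspace R m x -> @halfspace R m y -> 0 <= omega x y) &
      (forall (u : V -> R) (Du : V -> V),
       weak_gradient mu u Du -> (wenergy mu p gamma Du < +oo)%E ->
       {ae mu, forall x : Rn R m.+1, @halfspace R m x ->
         {ae mu, forall y : Rn R m.+1, @halfspace R m y ->
           (`|u x - u y|%:E <= (omega x y)%:E * (wenergy mu p gamma Du) `^ p^-1)%E}})].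

(** The tower equals [n] at [x] and 0 at [y], and [wenergy_tower] bounds its energy. Both orders of
    the points are recorded, as [omega] may be asymmetric. *)
Lemma modulus_tower mu (p gamma W s : R) omega (c x y : V) (n : nat) :
  is_lebesgue mu -> modulus mu p gamma omega -> 0 < p -> 0 < s ->
  (forall k, (k < n)%N ->
    (\int[mu]_(z in (@halfspace R m `&` hball c (s * 2 ^+ k) : set (Rn R m.+1)))
       ((lastc z) `^ gamma)%:E <= (W * (s * 2 ^+ k) `^ p)%:E)%E) ->
  halfspace x -> halfspace y ->
  sqdist c x <= s ^+ 2 -> 2 * (s * 2 ^+ n.-1) ^+ 2 <= sqdist c y ->
  n%:R <= omega x y * (n%:R * (12 `^ p * W)) `^ p^-1 /\
  n%:R <= omega y x * (n%:R * (12 `^ p * W)) `^ p^-1.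
Proof.
move=> mu_leb [com om0 hom] p0 s0 hW Hx Hy cx cy.
have := wenergy_tower p0 s0 hW.
set E := wenergy _ _ _ _; set C : R := n%:R * _ => EC.
have E0 : (0 <= E)%E.
  by apply: integral_ge0 => z _; rewrite lee_fin mulr_ge0 // powR_ge0.
have Ey : (E < +oo)%E by apply: le_lt_trans EC _; exact: ltry.
have [e Ee] : exists e : R, E = e%:E.
  by exists (fine E); rewrite fineK // ge0_fin_numE.
have e0 : 0 <= e by rewrite -lee_fin -Ee.
have eC : e <= C by rewrite -lee_fin -Ee.
have wg : weak_gradient mu (tower c s n) (gtower c s n).
  apply: classical_weak_gradient => //.
  - exact: continuous_tower.
  - by move=> i z; exact: is_derive_tower.
  - by move=> i; exact: continuous_gtower.
have ineq : {ae mu, forall z : Rn R m.+1, @halfspace R m z ->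
    {ae mu, forall t : Rn R m.+1, @halfspace R m t ->
      `|tower c s n z - tower c s n t| <= omega z t * e `^ p^-1}}.
  have := hom _ _ wg Ey; apply: filterS => z h Hz.
  have := h Hz; apply: filterS => t h' Ht.
  by have := h' Ht; rewrite -/E Ee poweR_EFin -EFinM lee_fin.
have key := ae_ineq_everywhere mu_leb com (@continuous_tower R _ c s n) ineq.
have eCp : e `^ p^-1 <= C `^ p^-1.
  by apply: ge0_ler_powR; rewrite ?nnegrE ?invr_ge0 ?(ltW p0) // (le_trans e0).
have T : tower c s n x - tower c s n y = n%:R.
  by rewrite tower_near // tower_far // subr0.
split.
  have := key x y Hx Hy; rewrite T ger0_norm // => /le_trans; apply.
  by rewrite ler_wpM2l // om0.
have := key y x Hy Hx; rewrite distrC T ger0_norm // => /le_trans; apply.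
by rewrite ler_wpM2l // om0.
Qed.

(** One bump around [x]: up to a constant, [q] is its oscillation 1 divided by the p-th root of its
    energy bound. *)
Lemma modulus_interior (p gamma : R) : 0 < p ->
  exists2 C : R, 0 < C &
  forall mu omega, is_lebesgue mu -> modulus mu p gamma omega ->
  forall x y : V, halfspace x -> halfspace y ->
  let h := lastc x in let d := enorm (x - y) in 0 < d ->
  let q := Num.min d h `^ (1 - m.+1%:R / p) * h `^ (- (gamma / p)) in
  C * q <= omega x y /\ C * q <= omega y x.
Proof.
move=> p0.
pose C0 : R := 48 * 2 `^ (`|gamma| / p).
have C00 : 0 < C0 by rewrite mulr_gt0 // powR_gt0.
exists C0^-1; first by rewrite invr_gt0.
move=> mu omega mu_leb hom x y Hx Hy h d d0 q.
have h0 : 0 < h by [].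
pose sg := Num.min d h.
have sg0 : 0 < sg by rewrite /sg lt_min d0.
(* With a quarter, [4 * s <= h] keeps the heights comparable to [h] and [4 * s <= d] puts [y]
   outside the bump. *)
pose s := sg / 4; have s0 : 0 < s by rewrite divr_gt0.
have s4 : 4 * s = sg by rewrite /s; field.
pose W := 2 `^ `|gamma| * h `^ gamma * sg ^+ m.+1 / s `^ p.
have sp0 : 0 < s `^ p by exact: powR_gt0.
have hW (k : nat) : (k < 1)%N ->
    (\int[mu]_(z in (@halfspace R m `&` hball x (s * 2 ^+ k) : set (Rn R m.+1)))
       ((lastc z) `^ gamma)%:E <= (W * (s * 2 ^+ k) `^ p)%:E)%E.
  rewrite ltnS leqn0 => /eqP ->; rewrite expr0 mulr1.
  have -> : W * s `^ p = 2 `^ `|gamma| * h `^ gamma * (4 * s) ^+ m.+1.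
    by rewrite /W s4 divfK // gt_eqF.
  by apply: weight_interior => //; rewrite s4 ge_min lexx orbT.
have xx : sqdist x x <= s ^+ 2.
  rewrite /sqdist big1 ?sqr_ge0 // => i _; by rewrite subrr expr0n.
have xy : 2 * (s * 2 ^+ 0) ^+ 2 <= sqdist x y.
  have -> : sqdist x y = d ^+ 2.
    by rewrite /d enorm_sqdist sqr_sqrtr ?sqdist_ge0 // sqdistC.
  have sd : 4 * s <= d by rewrite s4 ge_min lexx.
  by rewrite expr0 mulr1; nra.
have := modulus_tower mu_leb hom p0 s0 hW Hx Hy xx xy.
have q0 : 0 < q by rewrite mulr_gt0 ?powR_gt0.
have -> : (1%:R * (12 `^ p * W)) `^ p^-1 = C0 / q.
  have W0 : 0 < W by rewrite divr_gt0 // mulr_gt0 ?exprn_gt0 // mulr_gt0 ?powR_gt0.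
  have W1 : 0 < 12 `^ p * W by rewrite mulr_gt0 // powR_gt0.
  (* Both sides are products of powers, so logarithms make the identity linear; 48 is the 12 of the
     gradient bound times the 4 of [s = sg / 4]. *)
  rewrite mul1r; apply: ln_inj; rewrite ?posrE; [exact: powR_gt0|exact: divr_gt0|].
  rewrite ln_powR lnMp ?powR_gt0 // /W -powR_mulrn ?(ltW sg0) //.
  rewrite ln_divp ?mulr_gt0 ?powR_gt0 // !lnMp ?mulr_gt0 ?invr_gt0 ?powR_gt0 //.
  rewrite lnV ?posrE // /C0 /q !lnMp ?powR_gt0 // !ln_powR /s ln_divp //.
  have -> : 48 = 12 * 4 :> R by ring.
  by rewrite lnMp // -/sg; field; rewrite gt_eqF.
have Cq0 : 0 < C0 / q by exact: divr_gt0.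
by rewrite -!ler_pdivrMr // invf_div mul1r [C0^-1 * q]mulrC.
Qed.

Definition proj_boundary (x : V) : V := \row_i (if i == ord_max then 0 else x ord0 i).

Lemma lastc_proj (x : V) : lastc (proj_boundary x) = 0.
Proof. by rewrite /lastc mxE eqxx. Qed.

Lemma sqdist_proj_self (x : V) : sqdist (proj_boundary x) x = lastc x ^+ 2.
Proof.
rewrite /sqdist (bigD1 ord_max) //= big1 ?addr0 => [|i /negbTE h]; rewrite !mxE.
  by rewrite eqxx subr0.
by rewrite h subrr expr0n.
Qed.

(** Lowering the center from [x] to the boundary moves it away from [y], which is at least as high
    as [x]. *)
Lemma sqdist_proj_ge (x y : V) : 0 <= lastc x <= lastc y ->
  sqdist x y <= sqdist (proj_boundary x) y.
Proof.
move=> /andP[x0 xy]; apply: ler_sum => i _; rewrite !mxE.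
case: eqVneq => [->|//]; rewrite -!/(lastc _) subr0; nra.
Qed.

(** Around a boundary point the weight of a ball grows like its radius to the power
    [m.+1 + gamma = p - p * kappa]. Since [0 <= kappa], one constant [W] serves all the radii, and
    the energy of the tower is at most of order [n] times [s] to the power [- (p * kappa)]. *)
Lemma modulus_boundary (p gamma : R) : 0 < p -> -1 < gamma ->
  let kappa := 1 - (m.+1%:R + gamma) / p in 0 <= kappa ->
  exists2 C : R, 0 < C &
  forall mu omega, is_lebesgue mu -> modulus mu p gamma omega ->
  forall x y : V, halfspace x -> halfspace y -> lastc x <= lastc y ->
  forall (s : R) (n : nat), (0 < n)%N -> lastc x <= s ->
    s * 2 ^+ n.-1 <= enorm (x - y) / 2 ->
  let q := n%:R `^ (1 - p^-1) * s `^ kappa in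
  C * q <= omega x y /\ C * q <= omega y x.
Proof.
move=> p0 g1 kappa k0.
pose K : R := 2 `^ `|gamma| * 4 ^+ m / 2 * 2 `^ (1 + gamma) / (1 - 2^-1 `^ (1 + gamma)).
have K0 : 0 < K.
  have q1 : 2^-1 `^ (1 + gamma) < 1 :> R.
    have E1 : 1 `^ (1 + gamma) = 1 :> R by rewrite powR1.
    rewrite -[ltRHS]E1; apply: gt0_ltr_powR; rewrite ?nnegrE ?invr_ge0 //; first lra.
    by rewrite invf_lt1 // ltr1n.
  by rewrite /K !divr_gt0 ?mulr_gt0 ?powR_gt0 ?invr_gt0 ?exprn_gt0 // subr_gt0.
pose C0 : R := 12 * K `^ p^-1.
have C00 : 0 < C0 by rewrite mulr_gt0 // powR_gt0.
exists C0^-1; first by rewrite invr_gt0.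
move=> mu omega mu_leb hom x y Hx Hy ab s n n0 xs sd q.
set d := enorm (x - y) in sd.
have x0 : 0 < lastc x by [].
have s0 : 0 < s by exact: lt_le_trans xs.
pose W := K * s `^ (- (p * kappa)).
have hW (k : nat) : (k < n)%N ->
    (\int[mu]_(z in (@halfspace R m `&` hball (proj_boundary x) (s * 2 ^+ k) : set (Rn R m.+1)))
       ((lastc z) `^ gamma)%:E <= (W * (s * 2 ^+ k) `^ p)%:E)%E.
  move=> _; have sk0 := scale_gt0 k s0.
  have := weight_boundary mu_leb g1 sk0 (lastc_proj x).
  move=> /le_trans; apply; rewrite lee_fin; set sk := s * 2 ^+ k in sk0 *.
  have ssk : s <= sk by rewrite ler_pMr // exprn_ege1 // ler1n.
  have -> : 2 `^ `|gamma| * (4 * sk) ^+ m / 2 * (2 * sk) `^ (1 + gamma) /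
      (1 - 2^-1 `^ (1 + gamma)) = K * sk `^ (- (p * kappa)) * sk `^ p.
    rewrite exprMn powRM ?(ltW sk0) // /K.
    have E : sk ^+ m * sk `^ (1 + gamma) = sk `^ (- (p * kappa)) * sk `^ p.
      rewrite -powR_mulrn ?(ltW sk0) // -!powRD ?(gt_eqF sk0) ?implybT //.
      by congr (_ `^ _); rewrite /kappa -natr1; field; rewrite gt_eqF.
    by rewrite -[RHS]mulrA -E; ring.
  rewrite ler_wpM2r ?powR_ge0 // ler_wpM2l ?(ltW K0) // !powRN lef_pV2 ?posrE ?powR_gt0 //.
  by apply: ge0_ler_powR; rewrite ?nnegrE ?(ltW s0) ?(ltW sk0) // mulr_ge0 // ltW.
have xx : sqdist (proj_boundary x) x <= s ^+ 2.
  by rewrite sqdist_proj_self lerXn2r ?nnegrE // ltW.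
have xy : 2 * (s * 2 ^+ n.-1) ^+ 2 <= sqdist (proj_boundary x) y.
  have /(sqdist_proj_ge) : 0 <= lastc x <= lastc y by rewrite (ltW x0).
  apply: le_trans.
  have -> : sqdist x y = d ^+ 2.
    by rewrite /d enorm_sqdist sqr_sqrtr ?sqdist_ge0 // sqdistC.
  have := scale_gt0 n.-1 s0; move: sd; set t := s * _ => ? ?; nra.
have := modulus_tower mu_leb hom p0 s0 hW Hx Hy xx xy.
have n0' : 0 < n%:R :> R by rewrite ltr0n.
have q0 : 0 < q by rewrite mulr_gt0 ?powR_gt0.
have Cq0 : 0 < C0 / q by exact: divr_gt0.
have -> : (n%:R * (12 `^ p * W)) `^ p^-1 = C0 / q * n%:R.
  have W0 : 0 < W by rewrite mulr_gt0 // powR_gt0.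
  have N0 : 0 < n%:R * (12 `^ p * W) by apply: mulr_gt0 => //; apply: mulr_gt0 => //; exact: powR_gt0.
  apply: ln_inj; rewrite ?posrE; [exact: powR_gt0|exact: mulr_gt0|].
  have P0 : 0 < 12 `^ p by exact: powR_gt0.
  have W1 : 0 < 12 `^ p * W by exact: mulr_gt0.
  have S0 : 0 < s `^ (- (p * kappa)) by exact: powR_gt0.
  have Kp0 : 0 < K `^ p^-1 by exact: powR_gt0.
  rewrite ln_powR (lnMp n0' W1) (lnMp P0 W0) (lnMp K0 S0) (lnMp Cq0 n0') (ln_divp C00 q0).
  rewrite [ln C0](lnMp _ Kp0) // [ln q]lnMp ?powR_gt0 // !ln_powR.
  by field; rewrite gt_eqF.
have step t : n%:R <= t * (C0 / q * n%:R) -> C0^-1 * q <= t.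
  by rewrite mulrA -[leLHS]mul1r ler_pM2r // -ler_pdivrMr // mul1r invf_div mulrC.
by move=> [/step ? /step ?].
Qed.

End Modulus.

(** * Scalar bounds for each branch of [Theta] *)

Section Scalar.
Context {R : realType}.
Implicit Types a b d beta g : R.

Lemma ler_powR_base a b beta : 0 <= beta -> 0 <= a -> a <= b -> a `^ beta <= b `^ beta.
Proof.
by move=> b0 a0 ab; apply: ge0_ler_powR; rewrite ?nnegrE // (le_trans a0).
Qed.

(** Clearing powers reduces the claim to [d * a <= min d a * max b d]. *)
Lemma theta_neg_le a b d beta g : 0 < a -> a <= b -> 0 < d -> 0 < beta ->
  d `^ beta / (a `^ (- (beta - g)) * Num.max b d `^ beta)
    <= Num.min d a `^ beta * a `^ (- g).
Proof.
move=> a0 ab d0 b0; set M := Num.max b d; set sg := Num.min d a.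
have bM : b <= M by rewrite le_max lexx.
have dM : d <= M by rewrite le_max lexx orbT.
have sg0 : 0 < sg by rewrite lt_min d0.
have M0 : 0 < M by exact: lt_le_trans dM.
rewrite ler_pdivrMr ?mulr_gt0 ?powR_gt0 //.
have -> : a `^ (- (beta - g)) = a `^ g / a `^ beta.
  by rewrite -powRB ?(gt_eqF a0) ?implybT //; congr (_ `^ _); ring.
have -> : sg `^ beta * a `^ (- g) * (a `^ g / a `^ beta * M `^ beta) =
    (sg * M) `^ beta / a `^ beta.
  rewrite powRN powRM ?(ltW sg0) ?(ltW M0) //.
  by field; rewrite !gt_eqF ?powR_gt0.
rewrite ler_pdivlMr ?powR_gt0 // -powRM ?(ltW a0) ?(ltW d0) //.
apply: ler_powR_base; rewrite ?mulr_ge0 ?(ltW b0) ?(ltW a0) ?(ltW d0) //.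
by rewrite /sg; case: (leP d a) => h; nra.
Qed.

(** The two sides are in fact equal, because [min d b * max b d = d * b]. *)
Lemma theta_high_le b d beta g : 0 < b -> 0 < d -> 0 < beta ->
  b `^ (beta - g) * d `^ beta / Num.max b d `^ beta
    <= Num.min d b `^ beta * b `^ (- g).
Proof.
move=> b0 d0 be0; set M := Num.max b d; set sg := Num.min d b.
have sg0 : 0 < sg by rewrite lt_min d0.
have M0 : 0 < M by rewrite lt_max b0.
rewrite ler_pdivrMr ?powR_gt0 // powRD ?(gt_eqF b0) ?implybT //.
rewrite mulrAC [leRHS]mulrAC ler_wpM2r ?powR_ge0 // -!powRM ?(ltW b0) ?(ltW d0) ?(ltW sg0) ?(ltW M0) //.
apply: ler_powR_base; rewrite ?mulr_ge0 ?(ltW b0) ?(ltW be0) ?(ltW d0) //.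
by rewrite /sg /M; case: (leP d b) => h; rewrite le_eqVlt mulrC eqxx.
Qed.

Lemma powR_half_min a d beta : 0 < a -> 0 < d -> 0 < beta -> d <= 2 * a ->
  d `^ beta <= 2 `^ beta * Num.min d a `^ beta.
Proof.
move=> a0 d0 be0 da.
have sg0 : 0 < Num.min d a by rewrite lt_min d0.
rewrite -powRM ?(ltW sg0) //; apply: ler_powR_base; rewrite ?(ltW be0) ?(ltW d0) //.
by case: (leP d a) => h; lra.
Qed.

Lemma theta_mid_near_le a b d beta g : 0 < a -> a <= b -> b <= a + d -> 0 < d ->
  0 < beta -> d <= 2 * a ->
  d `^ beta / Num.max b d `^ g
    <= 2 `^ beta * (2 `^ `|g| * 2 `^ `|g|) * (Num.min d a `^ beta * a `^ (- g)).
Proof.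
move=> a0 ab bad d0 be0 da; set M := Num.max b d.
have aM : a <= M by rewrite le_max ab.
have Ma : M <= 3 * a by rewrite ge_max; apply/andP; split; lra.
rewrite -powRN.
(* [powR_dyadic] covers a factor 2 each way, while [M] ranges from [a] to [3 * a]; hence two
   applications, through [3 / 2 * a]. *)
have h1 : M `^ (- g) <= 2 `^ `|g| * (3 / 2 * a) `^ (- g).
  by rewrite -[X in 2 `^ X]normrN; apply: powR_dyadic; [lra|apply/andP; split; lra].
have h2 : (3 / 2 * a) `^ (- g) <= 2 `^ `|g| * a `^ (- g).
  by rewrite -[X in 2 `^ X]normrN; apply: powR_dyadic; [lra|apply/andP; split; lra].
have h3 : M `^ (- g) <= 2 `^ `|g| * (2 `^ `|g| * a `^ (- g)).
  by apply: le_trans h1 _; rewrite ler_wpM2l ?powR_ge0.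
have h4 := powR_half_min a0 d0 be0 da.
have := ler_pM (powR_ge0 d beta) (powR_ge0 M (- g)) h4 h3.
move=> /le_trans; apply; rewrite le_eqVlt; apply/orP; left; apply/eqP; ring.
Qed.

(** Here [b <= a + d <= 3 / 2 * d], so the maximum is comparable to [d]. *)
Lemma theta_mid_far_le a b d beta g : 0 < a -> a <= b -> b <= a + d ->
  0 < beta -> 2 * a <= d ->
  d `^ beta / Num.max b d `^ g <= 2 `^ `|g| * 2 `^ (beta - g) * (d / 2) `^ (beta - g).
Proof.
move=> a0 ab bad be0 da; set M := Num.max b d.
have d0 : 0 < d by lra.
have dM : d <= M by rewrite le_max lexx orbT.
have Md : M <= 2 * d by rewrite ge_max; apply/andP; split; lra.
rewrite -powRN -mulrA -powRM ?divr_ge0 ?(ltW d0) // mulrCA divff // mulr1.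
have h : M `^ (- g) <= 2 `^ `|g| * d `^ (- g).
  by rewrite -[X in 2 `^ X]normrN; apply: powR_dyadic; [lra|apply/andP; split; lra].
apply: le_trans (ler_wpM2l (powR_ge0 d beta) h) _.
by rewrite powRD ?(gt_eqF d0) ?implybT // mulrCA.
Qed.

(** [ln (1 + t) <= t] removes the logarithm, and the exponents multiply to [beta]. *)
Lemma theta_log_near_le a d alpha beta : 0 < a -> 0 < d -> 0 < beta -> 0 < alpha ->
  d <= 2 * a ->
  (ln (1 + (d / a) `^ (beta / alpha))) `^ alpha
    <= 2 `^ beta * (Num.min d a `^ beta * a `^ (- beta)).
Proof.
move=> a0 d0 be0 al0 da.
have da0 : 0 <= d / a by rewrite divr_ge0 // ltW.
apply: (@le_trans _ _ (((d / a) `^ (beta / alpha)) `^ alpha)).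
  apply: ler_powR_base; first exact: ltW.
    by rewrite ln_ge0 // lerDl powR_ge0.
  by apply: le_ln1Dx; rewrite (lt_le_trans _ (powR_ge0 _ _)) // ltrN10.
rewrite -powRrM divfK ?gt_eqF // powRM ?invr_ge0 ?(ltW d0) ?(ltW a0) //.
rewrite mulrA powRN -powR_inv1 ?(ltW a0) // -powRrM mulN1r powRN.
by rewrite ler_wpM2r ?invr_ge0 ?powR_ge0 //; exact: powR_half_min.
Qed.

(** As [d / a] is at most [2 ^+ n.+1], the logarithm is at most [ln 2 * (1 + (n + 1) * th)] with
    [th = beta / alpha], and [1 <= n] bounds this by [ln 2 * (1 + 2 * th) * n]. *)
Lemma theta_log_far_le a d alpha beta (n : nat) : 0 < a -> 0 < d -> 0 < beta -> 0 < alpha ->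
  (0 < n)%N -> d / 2 < a * 2 ^+ n ->
  (ln (1 + (d / a) `^ (beta / alpha))) `^ alpha
    <= (ln 2 * (1 + 2 * (beta / alpha))) `^ alpha * n%:R `^ alpha.
Proof.
move=> a0 d0 be0 al0 n0 dn.
set th := beta / alpha; have th0 : 0 < th by exact: divr_gt0.
have l2 : 0 < ln 2 :> R by rewrite ln_gt0 // ltr1n.
have n1 : 1 <= n%:R :> R by rewrite ler1n.
rewrite -powRM ?mulr_ge0 ?(ltW l2) //; last by rewrite addr_ge0 // mulr_ge0 // ltW.
apply: ler_powR_base; first exact: ltW.
  by rewrite ln_ge0 // lerDl powR_ge0.
have da : d / a <= 2 `^ n.+1%:R.
  rewrite powR_mulrn // exprSr ler_pdivrMr //; move: dn; set t := 2 ^+ n; nra.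
have da0 : 0 <= d / a by rewrite divr_ge0 // ltW.
have h1 : (d / a) `^ th <= 2 `^ (n.+1%:R * th).
  by rewrite powRrM; apply: ler_powR_base => //; exact: ltW.
have h2 : 1 <= 2 `^ (n.+1%:R * th) :> R.
  rewrite -[leLHS](powRr0 2); apply: ler_powR; first by rewrite ler1n.
  by rewrite mulr_ge0 // ltW.
have p0 : 0 < 1 + (d / a) `^ th by rewrite ltr_pwDl // powR_ge0.
apply: (@le_trans _ _ (ln (2 * 2 `^ (n.+1%:R * th)))).
  by rewrite ler_ln ?posrE ?mulr_gt0 ?powR_gt0 //; lra.
rewrite lnM ?posrE ?powR_gt0 // ln_powR -natr1.
rewrite -subr_ge0 (_ : _ - _ = ln 2 * (1 + th) * (n%:R - 1)); last by ring.
by rewrite mulr_ge0 ?subr_ge0 // mulr_ge0 ?(ltW l2) // addr_ge0 // ltW.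
Qed.

End Scalar.

(** * Matching the regimes of [Theta] with the test functions *)

Section Final.
Context {R : realType} {m : nat}.
Let V := 'rV[R]_m.+1.

Lemma enormC (x y : V) : enorm (x - y) = enorm (y - x).
Proof. by rewrite !enorm_sqdist sqdistC. Qed.

Lemma ThetaC (alpha beta kappa : R) (x y : V) :
  Theta alpha beta kappa x y = Theta alpha beta kappa y x.
Proof. by rewrite /Theta /= enormC (minC (lastc x)) (maxC (lastc x)). Qed.

Lemma lastc_le_enorm (x y : V) : lastc y <= lastc x + enorm (x - y).
Proof.
rewrite -lerBlDl enorm_sqdist (le_trans (ler_norm _)) // -sqrtr_sqr ler_wsqrtr //.
by rewrite sqdistC; exact: coord_sqdist.
Qed.

(** The least [n] with [t < a * 2 ^+ n] works; it is positive because [a <= t]. *)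
Lemma dyadic_scale (a t : R) : 0 < a -> a <= t ->
  exists2 n : nat, (0 < n)%N & a * 2 ^+ n.-1 <= t < a * 2 ^+ n.
Proof.
move=> a0 at_.
have ex : exists n : nat, t < a * 2 ^+ n.
  exists (Num.bound (t / a)); rewrite mulrC -ltr_pdivrMr //.
  exact: upper_nthrootP (leqnn _).
have [n h1 h2] := ex_minnP ex.
case: n h1 h2 => [|n] h1 h2; first by move: h1; rewrite expr0 mulr1 ltNge at_.
exists n.+1 => //; rewrite h1 andbT leNgt; apply/negP => /h2 h3.
by rewrite ltnn in h3.
Qed.

(** Coincident points leave no room for a bump and are treated apart. A power of 0 is 0 only for a
    nonzero exponent, whence the positivity of [alpha] and [beta]. *)
Lemma Theta_diag (alpha beta kappa : R) (x y : V) : 0 < alpha -> 0 < beta ->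
  enorm (x - y) = 0 -> Theta alpha beta kappa x y = 0.
Proof.
move=> al0 be0 d0; rewrite /Theta /= d0 mul0r.
have be : beta != 0 by rewrite gt_eqF.
have al : alpha != 0 by rewrite gt_eqF.
have ba : beta / alpha != 0 by rewrite gt_eqF // divr_gt0.
rewrite (powR0 be) (powR0 ba) addr0 ln1 (powR0 al).
by rewrite !mulr0 !mul0r; case: ifP => // _; case: ifP => // _; case: ifP.
Qed.

Lemma modulus_lower_ordered (p gamma : R) : m.+1%:R < p ->
  exists2 C : R, 0 < C &
  forall mu omega, is_lebesgue mu -> modulus mu p gamma omega ->
  forall x y : V, halfspace x -> halfspace y -> lastc x <= lastc y -> 0 < enorm (x - y) ->
  let th := Theta (1 - p^-1) (1 - m.+1%:R / p) (1 - (m.+1%:R + gamma) / p) x y in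
  C * th <= omega x y /\ C * th <= omega y x.
Proof.
move=> hp.
have N1 : 1 <= m.+1%:R :> R by rewrite ler1n.
have p0 : 0 < p by lra.
have p1 : 1 < p by lra.
set alpha := 1 - p^-1; set beta := 1 - m.+1%:R / p; set kappa := 1 - (m.+1%:R + gamma) / p.
have al0 : 0 < alpha by rewrite subr_gt0 invf_lt1.
have be0 : 0 < beta by rewrite subr_gt0 ltr_pdivrMr // mul1r.
pose g := gamma / p.
have kE : kappa = beta - g by rewrite /kappa /beta /g; field; rewrite gt_eqF.
have [C1 C10 int] := @modulus_interior R m p gamma p0.
(* Turns a lower bound by [C * q] into one by [(C / D) * th] as soon as [th <= D * q]. *)
have step (D q th w1 w2 : R) : 0 < D -> th <= D * q -> forall C : R, 0 < C ->
    C * q <= w1 /\ C * q <= w2 -> (C / D) * th <= w1 /\ (C / D) * th <= w2.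
  move=> D0 thD C C0 [h1 h2].
  have : C / D * th <= C * q.
    by rewrite -mulrA ler_pM2l // mulrC ler_pdivrMr // mulrC.
  by move=> h; split; apply: le_trans h _.
have [kneg|k0] := ltP kappa 0.
  exists C1 => // mu omega mu_leb hom x y Hx Hy ab d0 th.
  have := int mu omega mu_leb hom x y Hx Hy d0.
  have T : th <= 1 * (Num.min (enorm (x - y)) (lastc x) `^ beta * lastc x `^ (- g)).
    rewrite /th /Theta kneg (min_idPl ab) (max_idPr ab) mul1r kE.
    exact: theta_neg_le.
  by move=> /(step _ _ _ _ _ ltr01 T _ C10); rewrite divr1.
have [khigh|klow] := leP (1 + beta - alpha) kappa.
  exists C1 => // mu omega mu_leb hom x y Hx Hy ab d0 th.
  have d0' : 0 < enorm (y - x) by rewrite enormC.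
  (* The bump is centered at the upper point here, so the points are exchanged. *)
  have := int mu omega mu_leb hom y x Hy Hx d0'; rewrite enormC => -[h1 h2].
  have T : th <= 1 * (Num.min (enorm (x - y)) (lastc y) `^ beta * lastc y `^ (- g)).
    have k00 : kappa == 0 = false.
      apply/negbTE; rewrite gt_eqF // (lt_le_trans _ khigh) // /alpha.
      have pi0 : 0 < p^-1 by rewrite invr_gt0.
      by lra.
    rewrite /th /Theta ltNge k0 k00 ltNge khigh /= (max_idPr ab) mul1r kE.
    exact: theta_high_le.
  by have := step _ _ _ _ _ ltr01 T _ C10 (conj h2 h1); rewrite divr1.
(* [kappa < 1 + beta - alpha] reads [- p^-1 < g], and [g = gamma / p]. *)
have g1 : -1 < gamma.
  move: klow; rewrite kE /alpha; have : 0 < p^-1 by rewrite invr_gt0.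
  have -> : gamma = g * p by rewrite /g divfK // gt_eqF.
  have pp : p^-1 * p = 1 by rewrite mulVf // gt_eqF.
  move=> ? ?; have : - p^-1 < g by lra.
  by rewrite -(ltr_pM2r p0) mulNr pp.
have [C2 C20 bdy] := @modulus_boundary R m p gamma p0 g1 k0.
have [k00|kn0] := eqVneq kappa 0.
  have gE : g = beta by lra.
  pose D1 : R := 2 `^ beta; have D10 : 0 < D1 by exact: powR_gt0.
  pose D2 : R := (ln 2 * (1 + 2 * (beta / alpha))) `^ alpha.
  have l2 : 0 < ln 2 :> R by rewrite ln_gt0 // ltr1n.
  have D20 : 0 < D2.
    by rewrite powR_gt0 // mulr_gt0 // addr_gt0 // mulr_gt0 // divr_gt0.
  (* The minimum serves both near pairs, with an interior bump, and far pairs, with a tower. *)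
  exists (Num.min (C1 / D1) (C2 / D2)); first by rewrite lt_min !divr_gt0.
  move=> mu omega mu_leb hom x y Hx Hy ab d0 th.
  have thE : th = (ln (1 + (enorm (x - y) / lastc x) `^ (beta / alpha))) `^ alpha.
    by rewrite /th /Theta k00 ltxx eqxx (min_idPl ab).
  have th0 : 0 <= th by rewrite thE powR_ge0.
  have [near|far] := leP (enorm (x - y)) (2 * lastc x).
    have T := theta_log_near_le (Hx : 0 < lastc x) d0 be0 al0 near.
    rewrite -thE -[in X in _ * (_ * _ `^ (- X))]gE in T.
    have [h1 h2] := step _ _ _ _ _ D10 T _ C10 (int mu omega mu_leb hom x y Hx Hy d0).
    by split; [apply: le_trans h1|apply: le_trans h2];
      rewrite ler_wpM2r // ge_min lexx.
  have ax : lastc x <= enorm (x - y) / 2 by lra.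
  have [n n0 /andP[n1 n2]] := dyadic_scale (Hx : 0 < lastc x) ax.
  have T := theta_log_far_le (Hx : 0 < lastc x) d0 be0 al0 n0 n2.
  rewrite -thE in T.
  (* The tower starts at radius [lastc x] and uses every dyadic scale up to half the distance;
     [kappa = 0] makes the factor in [s] equal to 1. *)
  have := bdy mu omega mu_leb hom x y Hx Hy ab (lastc x) n n0 (lexx _) n1.
  rewrite -/kappa -/alpha k00 powRr0 mulr1 => h.
  have [h1 h2] := step _ _ _ _ _ D20 T _ C20 h.
  by split; [apply: le_trans h1|apply: le_trans h2];
    rewrite ler_wpM2r // ge_min lexx orbT.
pose D1 : R := 2 `^ beta * (2 `^ `|g| * 2 `^ `|g|).
have D10 : 0 < D1 by rewrite !mulr_gt0 ?powR_gt0.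
pose D2 : R := 2 `^ `|g| * 2 `^ (beta - g).
have D20 : 0 < D2 by rewrite mulr_gt0 ?powR_gt0.
exists (Num.min (C1 / D1) (C2 / D2)); first by rewrite lt_min !divr_gt0.
move=> mu omega mu_leb hom x y Hx Hy ab d0 th.
have thE : th = enorm (x - y) `^ beta / Num.max (lastc y) (enorm (x - y)) `^ g.
  rewrite /th /Theta ltNge k0 /= (negbTE kn0) klow (max_idPr ab).
  by congr (_ / _ `^ _); rewrite kE; ring.
have th0 : 0 <= th by rewrite thE divr_ge0 ?powR_ge0.
have bad := lastc_le_enorm x y.
have [near|far] := leP (enorm (x - y)) (2 * lastc x).
  have T := theta_mid_near_le g (Hx : 0 < lastc x) ab bad d0 be0 near.
  rewrite -thE in T.
  have [h1 h2] := step _ _ _ _ _ D10 T _ C10 (int mu omega mu_leb hom x y Hx Hy d0).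
  by split; [apply: le_trans h1|apply: le_trans h2];
    rewrite ler_wpM2r // ge_min lexx.
have T := theta_mid_far_le g (Hx : 0 < lastc x) ab bad be0 (ltW far).
rewrite -thE in T.
have ax : lastc x <= enorm (x - y) / 2 by lra.
have ax1 : enorm (x - y) / 2 * 2 ^+ 1.-1 <= enorm (x - y) / 2 by rewrite expr0 mulr1.
(* A single bump whose radius is half the distance. *)
have := bdy mu omega mu_leb hom x y Hx Hy ab (enorm (x - y) / 2) 1%N isT ax ax1.
rewrite powR1 mul1r -/kappa kE => h.
have [h1 h2] := step _ _ _ _ _ D20 T _ C20 h.
by split; [apply: le_trans h1|apply: le_trans h2];
  rewrite ler_wpM2r // ge_min lexx orbT.
Qed.

End Final.

(* The dimension is n = m.+1 (so n >= 1). *)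
Theorem theorem1p2 (R : realType) (m : nat) (gamma p : R)
  (hp : (m.+1)%:R < p) :
  exists C : R, 0 < C /\
  forall (mu : {measure set (Rn R m.+1) -> \bar R}), is_lebesgue mu ->
  forall omega : 'rV[R]_m.+1 -> 'rV[R]_m.+1 -> R,
    {within @halfspace R m `*` @halfspace R m, continuous (fun z => omega z.1 z.2)} ->
    (forall x y, @halfspace R m x -> @halfspace R m y -> 0 <= omega x y) ->
    (forall (u : 'rV[R]_m.+1 -> R) (Du : 'rV[R]_m.+1 -> 'rV[R]_m.+1),
       weak_gradient mu u Du -> (wenergy mu p gamma Du < +oo)%E ->
       {ae mu, forall x : Rn R m.+1, @halfspace R m x ->
         {ae mu, forall y : Rn R m.+1, @halfspace R m y ->
           (`|u x - u y|%:E <= (omega x y)%:E * (wenergy mu p gamma Du) `^ p^-1)%E}}) ->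
    forall x y, @halfspace R m x -> @halfspace R m y ->
      C * Theta (1 - p^-1) (1 - (m.+1)%:R / p) (1 - ((m.+1)%:R + gamma) / p) x y
        <= omega x y.
Proof.
have [C C0 H] := @modulus_lower_ordered R m p gamma hp.
exists C; split=> // mu mu_leb omega com om0 hom x y Hx Hy.
have N1 : 1 <= m.+1%:R :> R by rewrite ler1n.
have p0 : 0 < p by lra.
have M : modulus mu p gamma omega by [].
have [d0|d0] := eqVneq (enorm (x - y)) 0.
  rewrite Theta_diag ?mulr0 ?om0 //.
    by rewrite subr_gt0 invf_lt1 //; lra.
  by rewrite subr_gt0 ltr_pdivrMr // mul1r.
have {}d0 : 0 < enorm (x - y) by rewrite lt_neqAle eq_sym d0 sqrtr_ge0.
(* [H] bounds [omega] in both orders of its arguments, so the symmetry of [Theta] settles the case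
   where [y] is the lower point. *)
have [xy|/ltW yx] := leP (lastc x) (lastc y).
  by have [] := H mu omega mu_leb M x y Hx Hy xy d0.
rewrite ThetaC; rewrite enormC in d0.
by have [] := H mu omega mu_leb M y x Hy Hx yx d0.
Qed.
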